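(* Let $Y = Tf^\dagger + \sigma Z$ be the statistical linear inverse problem described in the context, and suppose that there are $0<c_{\min}\le c_{\max}$, $a\in\mathbb R$, $b>0$ and $0<\vartheta\le 1/2$ such that the eigenvalues of $T^*T$ satisfy $c_{\min}k^{-a}\exp(-bk^\vartheta)\le\lambda_k\le c_{\max}k^{-a}\exp(-bk^\vartheta)$ for all $k\in\mathbb N$. Let $\varphi=\varphi_{\nu,\tau}$, $\varphi_{\nu,\tau}(x)=x^\nu(-\log x)^{-\tau}$ (with $\varphi_{\nu,\tau}(0)=0$), where either $\nu>0$ and $\tau\in\mathbb R$, or $\nu=0$ and $\tau>0$, and let $\rho>0$. Let $(q_\alpha)_{\alpha\in\mathcal A}$ be an ordered filter such that $\varphi$ is a qualification of it, i.e. there is a constant $C_\varphi$ with $$\sup_{x\in[0,\|T^*T\|]}\varphi(x)\,(1-xq_\alpha(x))\le C_\varphi\,\varphi(\alpha)\quad\text{for all }\alpha\in\mathcal A\cap(0,\lambda_1].$$ Let $S:(0,\lambda_1]\to[0,\infty)$ be a smooth surrogate (as defined in the context). Let $(\alpha_m)_{m\in\mathbb N_0}\subset\mathcal A\cap(0,\lambda_1]$ be a candidate sequence with constants $1<\theta_1\le\theta_2<\infty$, and assume that there is a constant $c_{\rm v}>0$ such that $$\mathrm v_m\ \ge\ c_{\rm v}\,\sigma^2\,\frac{S(\alpha_m)}{(-\log\alpha_m)\,\alpha_m}\quad\text{for all } m\in\mathbb N_0.$$ Let $\beta,\gamma>0$, let $\hat f_\alpha=q_\alpha(T^*T)T^*Y$,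 and let $\alpha_{\hat m}\in\{\alpha_0,\dots,\alpha_{m_{\max}}\}$ be chosen by the SOLIT rule with parameters $\beta,\gamma$. Then there is a constant $C>0$, independent of $\sigma$, such that for all sufficiently small $\sigma>0$ $$\sup_{f^\dagger\in\mathcal W_{\varphi_{\nu,\tau}}(\rho)}\mathbb E\big[\|\hat f_{\alpha_{\hat m}}-f^\dagger\|^2\big]\ \le\ C\,(\sigma^2)^{\frac{2\nu}{2\nu+1}}\,(-\log\sigma^2)^{\frac{2\nu/\vartheta-2\tau}{2\nu+1}}.$$
   Context: **Model.** $\mathcal X,\mathcal Y$ are separable Hilbert spaces, $T:\mathcal X\to\mathcal Y$ is a linear, injective Hilbert–Schmidt operator, $f^\dagger\in\mathcal X$ is the unknown truth, $\sigma>0$ is the noise level, and $Z$ is the standard Gaussian Hilbert space process on $\mathcal Y$ (for each $y\in\mathcal Y$, $Z(y)$ is a centered real Gaussian variable, jointly Gaussian, with $\mathrm{Cov}(Z(y),Z(y'))=\langle y,y'\rangle$). The model $Y=Tf^\dagger+\sigma Z$ means that one observes $\langle Y,y\rangle=\langle Tf^\dagger,y\rangle+\sigma Z(y)$ for all $y\in\mathcal Y$. Since $T$ is Hilbert–Schmidt, $T^*Y$ and $T^*Z$ are (a.s.) $\mathcal X$-valued. $T^*T$ has an orthonormal eigenbasis $(e_k)_{k\in\mathbb N}$ with eigenvalues $\lambda_1\ge\lambda_2\ge\dots>0$, $\sum_k\lambda_k<\infty$, and it is assumed (without loss of generality) that $\lambda_1\le e^{-1}$. **Source set.** $\mathcal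 W_\varphi(\rho)=\{f\in\mathcal X: f=\varphi(T^*T)g\text{ for some }g\in\mathcal X,\ \|g\|\le\rho\}$. **Ordered filter.** Let $\mathcal A\subset(0,\infty)$ have $0$ as an accumulation point. A family of functions $q_\alpha:[0,\|T^*T\|]\to[0,\infty)$, $\alpha\in\mathcal A$, is an ordered filter if (i) there is a constant $C_q'$ with $\alpha q_\alpha(x)\le C_q'$ and $xq_\alpha(x)\le1$ for all $x\in[0,\|T^*T\|]$, $\alpha\in\mathcal A$; (ii) $\alpha\ge\tilde\alpha$ implies $q_\alpha(x)\le q_{\tilde\alpha}(x)$ for all $x$. **Smooth surrogate.** Let $\Sigma(x)=\#\{k\in\mathbb N:\lambda_k\ge x\}$. A smooth surrogate is a continuous function $S:(0,\lambda_1]\to[0,\infty)$ with $\liminf_{\alpha\to0}S(\alpha)/\Sigma(\alpha)>0$, $\lim_{\alpha\to0}\alpha S(\alpha)=0$, and for which there is a constant $C_S>0$ with $\frac1\alpha\int_0^\alpha\Sigma(t)\,dt\le C_SS(\alpha)$ for all $\alpha\in\mathcal A\cap(0,\lambda_1]$. (Under the exponential eigenvalue decay in the claim, the paper takes $S(x)\asymp(-\log x)^{1/\vartheta}$.) **Candidates.** Put $V(\alpha)=\sum_{k\ge1}\lambda_kq_\alpha(\lambda_k)^2$ for $\alpha\in\mathcal A$. A candidate sequence with constants $1<\theta_1\le\theta_2<\infty$ is a strictly decreasing sequence $\alpha_0>\alpha_1>\cdots$ in $\mathcal A$, not depending on $\sigma$, with $\theta_1\le V(\alpha_m)/V(\alpha_{m-1})\le\theta_2$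 for all $m\ge1$. Put $\mathrm v_m=\sigma^2V(\alpha_m)$ and $m_{\max}=\min\{m\in\mathbb N:\sigma^2V(\alpha_m)\ge1\}$. **SOLIT rule.** For $m_1,m_2\in\{0,\dots,m_{\max}\}$ let $\mathrm v_{m_1,m_2}=\sigma^2\sum_{k}\lambda_k(q_{\alpha_{m_1}}(\lambda_k)-q_{\alpha_{m_2}}(\lambda_k))^2$ and $\mathrm n_{m_1,m_2}=\|q_{\alpha_{m_1}}(T^*T)T^*Z-q_{\alpha_{m_2}}(T^*T)T^*Z\|$. For $m_1<m_2$ let $z_{m_1,m_2}(x)$ be such that $\mathbb P\{\mathrm n_{m_1,m_2}>z_{m_1,m_2}(x)\}=e^{-x}$, let $x_m=2(1+\gamma)\log(\mathrm v_{m+1}/\mathrm v_0)$, and let $\eta_{m_1,m_2}=\sigma z_{m_1,m_2}(x_{m_1})+\beta\sqrt{\mathrm v_{m_1,m_2}}$. Then $$\hat m=\min\Big\{0\le m_1\le m_{\max}:\ \|\hat f_{\alpha_{m_1}}-\hat f_{\alpha_{m_2}}\|\le\eta_{m_1,m_2}\ \text{ for all } m_1<m_2\le m_{\max}\Big\}$$ (the condition is vacuous for $m_1=m_{\max}$). *)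

(* Defs.v *)
From HB Require Import structures.
From mathcomp Require Import all_boot all_order all_algebra sesquilinear.
From mathcomp Require Import all_classical all_reals all_analysis.

Set Implicit Arguments.
Unset Strict Implicit.
Unset Printing Implicit Defensive.

Import Order.TTheory GRing.Theory Num.Theory.
Import numFieldNormedType.Exports.

Local Open Scope classical_set_scope.
Local Open Scope ring_scope.

(** A real Hilbert space is a [completeNormedModType R] [X] together with an
    inner product [ip : {dot X for idfun}] that induces its norm. *)

Definition induces_norm (R : realType) (X : completeNormedModType R)
    (ip : {dot X for idfun}) : Prop :=
  forall x : X, `|x| ^+ 2 = ip x x.

Definition separable (X : topologicalType) : Prop :=
  exists2 D : set X, countable D & dense D.

Definition orthonormal_basis (R : realType) (X : completeNormedModType R)
    (ip : {dot X for idfun}) (e : nat -> X) : Prop :=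
  (forall j k, ip (e j) (e k) = (j == k)%:R) /\
  (forall x : X, series (fun k => ip x (e k) *: e k) @ \oo --> x).

Definition is_adjoint (R : realType) (X Y : completeNormedModType R)
    (ipX : {dot X for idfun}) (ipY : {dot Y for idfun})
    (T : X -> Y) (Tadj : Y -> X) : Prop :=
  forall x y, ipY (T x) y = ipX x (Tadj y).

(** The sum of the [`|T (u k)| ^+ 2] does not depend on the basis [u].
    Bases are indexed by [nat], i.e. [X] is infinite-dimensional. *)
Definition hilbert_schmidt (R : realType) (X Y : completeNormedModType R)
    (ipX : {dot X for idfun}) (T : {linear X -> Y}) : Prop :=
  continuous T /\
  exists2 u : nat -> X, orthonormal_basis ipX u &
    cvgn (series (fun k => `|T (u k)| ^+ 2)).

Definition opnorm (R : realType) (X Y : completeNormedModType R)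
    (A : X -> Y) : R :=
  sup [set `|A x| | x in [set x : X | `|x| <= 1]].

(** The eigenvalues are indexed from 0: [lam k] stands for the (k+1)-st one. *)
Definition eigensystem (R : realType) (X : completeNormedModType R)
    (ip : {dot X for idfun}) (A : X -> X) (e : nat -> X) (lam : nat -> R)
    : Prop :=
  [/\ orthonormal_basis ip e,
      forall k, A (e k) = lam k *: e k,
      forall k, lam k.+1 <= lam k,
      forall k, 0 < lam k &
      cvgn (series lam)].

(** [phi(A) x] for the operator [A] with eigensystem [(e, lam)]. *)
Definition fcalc (R : realType) (X : completeNormedModType R)
    (ip : {dot X for idfun}) (e : nat -> X) (lam : nat -> R)
    (phi : R -> R) (x : X) : X :=
  limn (series (fun k => (phi (lam k) * ip x (e k)) *: e k)).

(** [normal_prob m 0] is not the Dirac mass at [m] (the library takes the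
    uniform law on [[0, 1]] there), hence the case distinction. *)
Definition gaussian_law (d : measure_display) (Omega : measurableType d)
    (R : realType) (P : probability Omega R) (f : Omega -> R) (m s : R) : Prop :=
  forall B : set R, measurable B ->
    P (f @^-1` B) = if s == 0 then \d_m B else normal_prob m s B.

Definition gaussian (d : measure_display) (Omega : measurableType d)
    (R : realType) (P : probability Omega R) (f : Omega -> R) : Prop :=
  exists m s : R, 0 <= s /\ gaussian_law P f m s.

Definition standard_gaussian_process (d : measure_display)
    (Omega : measurableType d) (R : realType) (P : probability Omega R)
    (Y : completeNormedModType R) (ip : {dot Y for idfun})
    (Z : Y -> {RV P >-> R}) : Prop :=
  [/\ forall (n : nat) (a : 'I_n -> R) (y : 'I_n -> Y),
        gaussian P (fun w => \sum_(i < n) a i * Z (y i) w),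
      forall y, 'E_P[Z y]%E = 0%E &
      forall y y', covariance P (Z y) (Z y') = (ip y y')%:E].

Definition observation (d : measure_display) (Omega : measurableType d)
    (R : realType) (P : probability Omega R) (X Y : completeNormedModType R)
    (ipY : {dot Y for idfun}) (T : X -> Y) (Z : Y -> {RV P >-> R})
    (f : X) (sigma : R) : Y -> Omega -> R :=
  fun y w => ipY (T f) y + sigma * Z y w.

(** [W] is an [X]-valued version of [T^* G] for a process [G] indexed by [Y]:
    a Borel random variable with [<W, x> = G(T x)] almost surely, for every
    [x]. Two such versions agree almost surely. *)
Definition adjoint_version (d : measure_display) (Omega : measurableType d)
    (R : realType) (P : probability Omega R) (X Y : completeNormedModType R)
    (ipX : {dot X for idfun}) (T : X -> Y) (G : Y -> Omega -> R)
    (W : Omega -> X) : Prop :=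
  (forall U : set X, open U -> measurable (W @^-1` U)) /\
  (forall x : X, {ae P, forall w, ipX (W w) x = G (T x) w}).

Definition phi_log (R : realType) (nu tau : R) (x : R) : R :=
  if x == 0 then 0 else x `^ nu * (- ln x) `^ (- tau).

Definition source_set (R : realType) (X : completeNormedModType R)
    (ip : {dot X for idfun}) (e : nat -> X) (lam : nat -> R)
    (phi : R -> R) (rho : R) : set X :=
  [set f | exists2 g : X, `|g| <= rho & f = fcalc ip e lam phi g].

(** [L] plays the role of [||T^* T||]; [q alpha] is only constrained on
    [[0, L]], and only for [alpha] in [A]. *)
Definition ordered_filter (R : realType) (A : set R) (L : R)
    (q : R -> R -> R) : Prop :=
  [/\ forall alpha x, A alpha -> 0 <= x <= L -> 0 <= q alpha x,
      exists Cq : R, forall alpha x, A alpha -> 0 <= x <= L ->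
        alpha * q alpha x <= Cq /\ x * q alpha x <= 1 &
      forall alpha alpha' x, A alpha -> A alpha' -> 0 <= x <= L ->
        alpha' <= alpha -> q alpha x <= q alpha' x].

Definition qualification (R : realType) (A : set R) (L lam1 : R)
    (q : R -> R -> R) (phi : R -> R) : Prop :=
  exists C : R, forall alpha, A alpha -> 0 < alpha <= lam1 ->
    forall x, 0 <= x <= L -> phi x * (1 - x * q alpha x) <= C * phi alpha.

Definition Sigma (R : realType) (lam : nat -> R) (x : R) : \bar R :=
  counting [set k | x <= lam k].

Definition smooth_surrogate (R : realType) (A : set R) (lam : nat -> R)
    (S : R -> R) : Prop :=
  [/\ {within `]0, lam 0%N], continuous S},
      forall x, 0 < x <= lam 0%N -> 0 <= S x,
      (0 < limf_einf (fun alpha => (S alpha / fine (Sigma lam alpha))%:E)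
                     (0 : R)^'+)%E,
      (fun alpha => alpha * S alpha) @ (0 : R)^'+ --> (0 : R) &
      exists2 CS : R, 0 < CS & forall alpha, A alpha ->
        0 < alpha <= lam 0%N ->
        ((alpha^-1)%:E *
          \int[lebesgue_measure]_(t in `]0%R, alpha]) Sigma lam t
           <= (CS * S alpha)%:E)%E].

Definition Vfun (R : realType) (lam : nat -> R) (q : R -> R -> R)
    (alpha : R) : R :=
  limn (series (fun k => lam k * q alpha (lam k) ^+ 2)).

Definition Vdiff (R : realType) (lam : nat -> R) (q : R -> R -> R)
    (alpha alpha' : R) : R :=
  limn (series (fun k => lam k * (q alpha (lam k) - q alpha' (lam k)) ^+ 2)).

Definition candidate_sequence (R : realType) (A : set R) (lam : nat -> R)
    (q : R -> R -> R) (theta1 theta2 : R) (al : nat -> R) : Prop :=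
  [/\ 1 < theta1 <= theta2,
      forall m, A (al m),
      forall m, al m.+1 < al m &
      forall m, theta1 <= Vfun lam q (al m.+1) / Vfun lam q (al m) <= theta2].

(** The value on the empty set is 0. *)
Definition nat_min (Q : set nat) : nat :=
  xget 0%N [set m | Q m /\ forall j, Q j -> (m <= j)%N].

Definition vm (R : realType) (lam : nat -> R) (q : R -> R -> R)
    (al : nat -> R) (sigma : R) (m : nat) : R :=
  sigma ^+ 2 * Vfun lam q (al m).

(** The minimum is over the positive integers. *)
Definition mmax (R : realType) (lam : nat -> R) (q : R -> R -> R)
    (al : nat -> R) (sigma : R) : nat :=
  nat_min [set m | (1 <= m)%N /\ 1 <= vm lam q al sigma m].

(** [q_alpha(T^* T) h]; applied to [h = T^* Y] it is the estimator. *)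
Definition fhat (R : realType) (X : completeNormedModType R)
    (ip : {dot X for idfun}) (e : nat -> X) (lam : nat -> R)
    (q : R -> R -> R) (alpha : R) (h : X) : X :=
  fcalc ip e lam (q alpha) h.

Definition noise_diff (R : realType) (X : completeNormedModType R)
    (ip : {dot X for idfun}) (e : nat -> X) (lam : nat -> R)
    (q : R -> R -> R) (al : nat -> R) (m1 m2 : nat) (h : X) : R :=
  `|fhat ip e lam q (al m1) h - fhat ip e lam q (al m2) h|.

(** [z m1 m2] is the tail quantile function of [n_{m1, m2}]; no such value
    exists for [x < 0], and at [x = 0] it is not unique and never used. *)
Definition tail_quantile (d : measure_display) (Omega : measurableType d)
    (R : realType) (P : probability Omega R) (n : nat -> nat -> Omega -> R)
    (z : nat -> nat -> R -> R) : Prop :=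
  forall m1 m2, (m1 < m2)%N -> forall x, 0 < x ->
    P [set w | z m1 m2 x < n m1 m2 w] = (expR (- x))%:E.

Definition xm (R : realType) (lam : nat -> R) (q : R -> R -> R)
    (al : nat -> R) (sigma gamma : R) (m : nat) : R :=
  2 * (1 + gamma) * ln (vm lam q al sigma m.+1 / vm lam q al sigma 0%N).

Definition eta (R : realType) (lam : nat -> R) (q : R -> R -> R)
    (al : nat -> R) (z : nat -> nat -> R -> R) (beta gamma sigma : R)
    (m1 m2 : nat) : R :=
  sigma * z m1 m2 (xm lam q al sigma gamma m1)
  + beta * Num.sqrt (sigma ^+ 2 * Vdiff lam q (al m1) (al m2)).

Definition solit (R : realType) (X : completeNormedModType R)
    (ip : {dot X for idfun}) (e : nat -> X) (lam : nat -> R)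
    (q : R -> R -> R) (al : nat -> R) (z : nat -> nat -> R -> R)
    (beta gamma sigma : R) (h : X) : nat :=
  nat_min [set m1 | (m1 <= mmax lam q al sigma)%N /\
    forall m2, (m1 < m2 <= mmax lam q al sigma)%N ->
      `|fhat ip e lam q (al m1) h - fhat ip e lam q (al m2) h|
        <= eta lam q al z beta gamma sigma m1 m2].

(* Main.v *)
Require Import Defs.
From HB Require Import structures.
From mathcomp Require Import all_boot all_order all_algebra sesquilinear.
From mathcomp Require Import all_classical all_reals all_analysis.
From mathcomp Require Import measurable_realfun ring lra.

Set Implicit Arguments.
Unset Strict Implicit.
Unset Printing Implicit Defensive.

Import Order.TTheory GRing.Theory Num.Theory.
Import numFieldNormedType.Exports.

Local Open Scope classical_set_scope.
Local Open Scope ring_scope.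

(** Write [W_k = <T^* Z, e_k>]. By the source condition and the qualification,
    the bias of [fhat_(al m)] is at most a constant times [phi (al m)]; let [M]
    be the first [m] at which this bound is dominated by [sqrt (v_m)].

    All noise norms are weighted sums [sum_k d_k^2 W_k^2], and the [W_k] are
    jointly subgaussian with variances [lam k]; integrating
    [exp (d^2 W^2) = E_g exp (sqrt 2 d g W)] over auxiliary normal variables [g]
    gives [E exp (sum_k d_k^2 W_k^2 / (4 A)) <= exp (v / (2 A))], where [v] is
    the sum and [A] a bound of the [d_k^2 lam k]. With [A] of the order of
    [1 / al m] this bounds the quantiles by [z(x)^2 <= 2 v + O(x / al m)]. As
    [x_m = O(- ln (al m))] and, thanks to [vartheta <= 1/2], the surrogate
    satisfies [S x >= c (ln x)^2], the hypothesis on [v_m] absorbs the second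
    term: the thresholds up to [M] are [O(sqrt (v_M))] and no logarithm is lost.

    If the rule stops at some [m <= M], the threshold compares the estimator with
    the one at [M]. If it stops at [m.+1 > M], then at [m] the noise exceeded a
    quantile, which has probability at most
    [mmax * (v_(m.+1) / v_0) ^ (-2 (1 + gamma))]; these events contribute
    [O(sigma^2 mmax^2)] only. Finally [v_M] is bounded by balancing
    [phi (al)^2] against [V (al) = O((- ln al)^(1/vartheta) / al)]. *)

(** * Orthonormal bases and multipliers *)

(** The noise quantile in the threshold is never asked to dominate the bias: that is the task of the
    summand [beta * sqrt (v_(m, m2))]. It succeeds because [V] grows geometrically along the
    candidates, so that [v_(m, m2)] is at least [eps^2 * v_m2] with [eps = (1 - 1 / theta1) / 2];
    this is where the factor [beta * eps] in the choice of [M] comes from. The ratio [theta2] enters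
    through the predecessor of [M]: there the squared bias bound still exceeds a multiple of the
    variance, the two are balanced, and [theta2] carries the result over to [M].

    The exponential moment is used at two scales. For the first and second moments of the noise
    [A = V (al m)] is enough. For the quantiles [A] must be [Cq / al m]: a term of order
    [V (al m) * x_m] would cost a logarithm.

    The factor 2 in [x_m] is used up by a Cauchy-Schwarz step: the square root of the probability of
    a late stop, [(v_(m.+1) / v_0) ^ (- (1 + gamma))], still compensates the growth of the variance
    at the late index. *)

Section InnerProduct.
Variables (R : realType) (X : completeNormedModType R).
Variables (ip : {dot X for idfun}) (hip : induces_norm ip).

Lemma ipC u v : ip u v = ip v u.
Proof. by rewrite hermC expr0 mul1r. Qed.

Lemma ipDl u v w : ip (u + v) w = ip u w + ip v w.
Proof. exact: linearDl. Qed.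

Lemma ipBl u v w : ip (u - v) w = ip u w - ip v w.
Proof. exact: linearBl. Qed.

Lemma ipZl a u w : ip (a *: u) w = a * ip u w.
Proof. exact: linearZl_LR. Qed.

Lemma ipZr a u w : ip w (a *: u) = a * ip w u.
Proof. by rewrite ipC ipZl ipC. Qed.

Lemma ip_suml (I : Type) (r : seq I) (E : I -> X) w :
  ip (\sum_(i <- r) E i) w = \sum_(i <- r) ip (E i) w.
Proof.
elim: r => [|i r IH]; first by rewrite !big_nil linear0l.
by rewrite !big_cons ipDl IH.
Qed.

Lemma ip_Cauchy_Schwarz u v : `|ip u v| <= `|u| * `|v|.
Proof.
have [->|v0] := eqVneq v 0; first by rewrite linear0r !normr0 mulr0.
have vv : 0 < ip v v by rewrite -hip exprn_gt0// normr_gt0.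
have : 0 <= ip v v * ip (u - (ip u v / ip v v) *: v) (u - (ip u v / ip v v) *: v).
  by rewrite mulr_ge0 ?(ltW vv)// -hip sqr_ge0.
rewrite ipBl ipZl (ipC u) (ipC v) !ipBl !ipZl.
rewrite (ipC v u) => h.
rewrite -(@ler_pXn2r _ 2)// ?nnegrE ?mulr_ge0// exprMn !hip real_normK ?num_real//.
move: h; set a := ip u v; set b := ip v v; set c := ip u u => h.
suff -> : c * b = a ^+ 2 + b * (c - a / b * a - a / b * (a - a / b * b)).
  by rewrite lerDl.
by rewrite divfK ?gt_eqF// subrr mulr0 subr0 mulrBr mulrCA -/b; field; rewrite gt_eqF.
Qed.

Lemma cvg_ip (u_ : X^nat) u v :
  u_ @ \oo --> u -> (fun n => ip (u_ n) v) @ \oo --> ip u v.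
Proof.
move=> uu; apply/cvgrPdist_le => eps eps0.
have v0 : 0 < eps / (`|v| + 1) by rewrite divr_gt0// ltr_wpDl.
move/cvgrPdist_le : uu => /(_ _ v0); apply: filterS => n un.
rewrite -ipBl (le_trans (ip_Cauchy_Schwarz _ _))//.
rewrite (@le_trans _ _ (eps / (`|v| + 1) * (`|v| + 1)))//.
  by rewrite ler_pM// lerDl.
by rewrite divfK// gt_eqF// ltr_wpDl.
Qed.

(** Of [W] it is only known that open sets have measurable preimages. By Cauchy-Schwarz [ip _ x] is
    continuous, so open intervals, which generate the Borel sets of [R], pull back to open sets of
    [X]. *)
Lemma measurable_ip d (T : measurableType d) (W : T -> X) x :
  (forall U : set X, open U -> measurable (W @^-1` U)) ->
  measurable_fun setT (fun w => ip (W w) x).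
Proof.
move=> mW; apply: (measurability (@RGenOpens.G R)).
  exact: RGenOpens.measurableE.
move=> _ [_ [a [b ->]] <-]; rewrite setTI.
rewrite (_ : _ @^-1` _ = W @^-1` ((fun y => ip y x) @^-1` `]a, b[)%classic)//.
apply: mW; apply: open_comp; last exact: interval_open.
move=> y _; apply/cvgrPdist_le => eps eps0.
have v0 : 0 < eps / (`|x| + 1) by rewrite divr_gt0// ltr_wpDl.
have /cvgrPdist_le/(_ _ v0) : y' @[y' --> y] --> y by exact: cvg_id.
apply: filterS => z yz.
rewrite -ipBl (le_trans (ip_Cauchy_Schwarz _ _))//.
rewrite (@le_trans _ _ (eps / (`|x| + 1) * (`|x| + 1)))//.
  by rewrite ler_pM// lerDl.
by rewrite divfK// gt_eqF// ltr_wpDl.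
Qed.

Variables (e : nat -> X) (he : orthonormal_basis ip e).

Lemma ip_psum (c : nat -> R) m n j :
  ip (\sum_(m <= k < n) c k *: e k) (e j) = if (m <= j < n)%N then c j else 0.
Proof.
rewrite ip_suml.
under eq_bigr do rewrite ipZl he.1.
have [jmn|] := boolP (m <= j < n)%N.
  rewrite (bigD1_seq j)/= ?iota_uniq//; last by rewrite mem_index_iota.
  rewrite eqxx mulr1 big1 ?addr0// => i /= ij.
  by rewrite (negbTE ij) mulr0.
move=> jmn; rewrite big_nat big1// => i imn.
have -> : (i == j) = false by apply/negP => /eqP ij; move: jmn; rewrite -ij imn.
by rewrite mulr0.
Qed.

Lemma norm_psum (c : nat -> R) m n :
  `|\sum_(m <= k < n) c k *: e k| ^+ 2 = \sum_(m <= k < n) c k ^+ 2.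
Proof.
rewrite hip ip_suml big_nat [RHS]big_nat; apply: eq_bigr => i imn.
by rewrite ipZl ipC ip_psum imn.
Qed.

Lemma coef_of_cvg (c : nat -> R) y j :
  series (fun k => c k *: e k) @ \oo --> y -> ip y (e j) = c j.
Proof.
move=> /(@cvg_ip _ _ (e j)) h.
apply: (@cvg_unique _ (@norm_hausdorff _ R^o)  _ _ _ _ h).
apply: cvg_near_cst; exists j.+1 => // n /= jn.
by rewrite /series/= ip_psum leq0n/= jn.
Qed.

Lemma norm_of_cvg (c : nat -> R) y :
  series (fun k => c k *: e k) @ \oo --> y ->
  series (fun k => c k ^+ 2) @ \oo --> `|y| ^+ 2.
Proof.
move=> h; rewrite (_ : series _ = (fun n => `|series (fun k => c k *: e k) n| ^+ 2)).
  apply: (@cvg_comp _ _ _ (fun n => `|series (fun k => c k *: e k) n|)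
    (fun t : R => t ^+ 2)); first exact: (cvg_norm h).
  exact: exprn_continuous.
by apply/funext => n; rewrite norm_psum.
Qed.

Lemma Parseval x : series (fun k => ip x (e k) ^+ 2) @ \oo --> `|x| ^+ 2.
Proof. exact/norm_of_cvg/he.2. Qed.

Lemma coef_inj x y : (forall k, ip x (e k) = ip y (e k)) -> x = y.
Proof.
move=> xy; apply: (@cvg_unique _ (@norm_hausdorff _ X) _ _ _ _ (he.2 x)).
rewrite (_ : (fun _ => _) = (fun k => ip y (e k) *: e k)); first exact: he.2.
by apply/funext => k; rewrite xy.
Qed.

(** All bias estimates go through this comparison: in the eigenbasis they become inequalities
    between the scalars [1 - lam k * q (al m) (lam k)]. *)
Lemma norm_le_coef c x y : 0 <= c ->
  (forall k, `|ip x (e k)| <= c * `|ip y (e k)|) -> `|x| <= c * `|y|.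
Proof.
move=> c0 xy.
rewrite -(@ler_pXn2r _ 2)// ?nnegrE ?mulr_ge0// exprMn.
pose s z := series (fun k => ip z (e k) ^+ 2).
apply: (@ler_cvg_to _ \oo _ _ (s x) (fun n => c ^+ 2 * s y n)).
- exact: (@Parseval x).
- by apply: cvgM; [exact: cvg_cst|exact: (@Parseval y)].
apply: nearW => n; rewrite /s /series/= mulr_sumr ler_sum// => k _.
rewrite -exprMn -[leLHS]real_normK ?num_real// -[leRHS]real_normK ?num_real//.
by rewrite ler_pXn2r ?nnegrE// normrM (ger0_norm c0).
Qed.

Variable lam : nat -> R.

Section fcalc.
Variables (phi : R -> R) (M : R) (phiM : forall k, `|phi (lam k)| <= M).

(** [fcalc] is a bare [limn] and says nothing until convergence is known. A bounded multiplier
    enlarges the norm of each block of the expansion of [x] by at most [M], so the Cauchy criterion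
    is inherited. *)
Lemma fcalc_cvg x :
  series (fun k => (phi (lam k) * ip x (e k)) *: e k) @ \oo
    --> fcalc ip e lam phi x.
Proof.
suff : cvgn (series (fun k => (phi (lam k) * ip x (e k)) *: e k)) by [].
apply/cauchy_cvgP/cauchy_seriesP => eps eps0.
have M0 : 0 <= M := le_trans (normr_ge0 _) (phiM 0%N).
have d0 : 0 < eps / (M + 1) by rewrite divr_gt0// ltr_wpDl.
have /cauchy_cvgP/cauchy_seriesP/(_ _ d0) : cvgn (series (fun k => ip x (e k) *: e k)).
  by apply/cvg_ex; exists x; exact: he.2.
apply: filterS => -[m n]/= mn.
apply: (@le_lt_trans _ _ (M * `|\sum_(m <= k < n) ip x (e k) *: e k|)).
  rewrite -(@ler_pXn2r _ 2)// ?nnegrE ?mulr_ge0// exprMn !norm_psum.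
  rewrite mulr_sumr ler_sum// => k _; rewrite exprMn ler_wpM2r ?sqr_ge0//.
  by rewrite -real_normK ?num_real// ler_pXn2r// nnegrE.
apply: (@le_lt_trans _ _ ((M + 1) * `|\sum_(m <= k < n) ip x (e k) *: e k|)).
  by rewrite ler_wpM2r// lerDl.
by rewrite -ltr_pdivlMl ?ltr_wpDl// mulrC.
Qed.

Lemma fcalc_coef x k : ip (fcalc ip e lam phi x) (e k) = phi (lam k) * ip x (e k).
Proof. exact: (coef_of_cvg k (@fcalc_cvg x)). Qed.

Lemma fcalc_norm x :
  series (fun k => (phi (lam k) * ip x (e k)) ^+ 2) @ \oo
    --> `|fcalc ip e lam phi x| ^+ 2.
Proof. exact: norm_of_cvg (@fcalc_cvg x). Qed.

End fcalc.

End InnerProduct.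

(** * Gaussian integrals *)

Section NormalIntegral.
Variables (R : realType) (m s : R).
Local Notation mu := (@lebesgue_measure R).
Local Open Scope ereal_scope.

Import HBNNSimple.

Local Notation nu := (normal_prob m s).

Let nnsfun_integral_normal_prob (f : {nnsfun measurableTypeR R >-> R}) :
  \int[nu]_x (f x)%:E = \int[mu]_x ((f x)%:E * (normal_pdf m s x)%:E).
Proof.
have EFinf x : (f x)%:E =
  \sum_(k \in range f) k%:E * (\1_(f @^-1` [set k]) x)%:E.
  by rewrite fsumEFin //= fimfunE.
under [LHS]eq_integral do rewrite EFinf.
rewrite ge0_integral_fsum //; last 2 first.
  - by move=> r; exact/measurable_EFinP/measurableT_comp.
  - by move=> r /= z _; exact: nnfun_muleindic_ge0.
have mpdf := @measurable_normal_pdf R m s.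
transitivity (\sum_(k \in range f) \int[mu]_x
    (k%:E * (\1_(f @^-1` [set k]) x)%:E * (normal_pdf m s x)%:E)).
  apply: eq_fsbigr => i; rewrite inE => -[z _ <-{i}].
  rewrite ge0_integralZl//; last 2 first.
    - exact/measurable_EFinP.
    - by rewrite lee_fin.
  rewrite integral_indic// setIT.
  under [RHS]eq_integral do rewrite -muleA.
  rewrite ge0_integralZl//; last 3 first.
    - apply: emeasurable_funM; first exact/measurable_EFinP.
      exact/measurable_EFinP.
    - by move=> x _; rewrite mule_ge0// lee_fin// normal_pdf_ge0.
    - by rewrite lee_fin.
  congr (_ * _); rewrite [LHS]/= /normal_prob [LHS]integral_mkcond.
  apply: eq_integral => x _; rewrite patchE indicE; case: ifPn => _.
    by rewrite mul1e.
  by rewrite mul0e.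
rewrite -ge0_integral_fsum//.
- apply: eq_integral => x _; rewrite EFinf ge0_mule_fsuml// => r.
  exact: nnfun_muleindic_ge0.
- move=> r; apply: emeasurable_funM; last exact/measurable_EFinP.
  exact/measurable_EFinP/measurableT_comp.
- move=> r x _; apply: mule_ge0; first exact: nnfun_muleindic_ge0.
  by rewrite lee_fin normal_pdf_ge0.
Qed.

(** Passage from the normal law to its density: linearity for simple functions, then monotone
    convergence. *)
Lemma ge0_integral_normal_prob (g : measurableTypeR R -> \bar R) :
  measurable_fun setT g -> (forall x, 0 <= g x) ->
  \int[nu]_x g x = \int[mu]_x (g x * (normal_pdf m s x)%:E).
Proof.
move=> mg g0; pose f := nnsfun_approx measurableT mg.
have fg x : (f n x)%:E @[n --> \oo] --> g x by exact: cvg_nnsfun_approx.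
have mpdf := @measurable_normal_pdf R m s.
rewrite [LHS](_ : _ = limn (fun n => \int[nu]_x (f n x)%:E)); last first.
  rewrite -monotone_convergence//; last 3 first.
    - by move=> n; exact/measurable_EFinP.
    - by move=> n /= x _; rewrite lee_fin; exact: fun_ge0.
    - by move=> y /= _ a b ab; rewrite lee_fin; exact/lefP/nd_nnsfun_approx.
  by apply: eq_integral => x _; apply/esym/cvg_lim => //; exact: fg.
under eq_fun do rewrite nnsfun_integral_normal_prob.
rewrite -monotone_convergence//; last 3 first.
- move=> n; apply: emeasurable_funM; exact/measurable_EFinP.
- by move=> n x _; rewrite mule_ge0// lee_fin ?normal_pdf_ge0.
- move=> y /= _ a b ab; rewrite lee_wpmul2r ?lee_fin ?normal_pdf_ge0//.
  exact/lefP/nd_nnsfun_approx.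
apply: eq_integral => x _; apply/cvg_lim => //.
by apply: cvgeZr => //; exact: fg.
Qed.

End NormalIntegral.

Section GaussianIntegrals.
Variable R : realType.

(** Completing the square: the integrand times the density is a constant times the normal density
    with mean [m'] and standard deviation [s' = s / sqrt D], which integrates to 1. *)
Lemma integral_normal_exp_quad (m s al be : R) : s != 0 -> 2 * al * s ^+ 2 < 1 ->
  let D := 1 - 2 * al * s ^+ 2 in
  (\int[normal_prob m s]_x (expR (al * x ^+ 2 + be * x))%:E
   = ((Num.sqrt D)^-1 *
       expR ((al * m ^+ 2 + be * m + be ^+ 2 * s ^+ 2 / 2) / D))%:E)%E.
Proof.
move=> s0 sD D; have D0 : 0 < D by rewrite subr_gt0.
have mexp : measurable_fun setT (fun x : R => expR (al * x ^+ 2 + be * x)).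
  apply: measurableT_comp => //; apply: measurable_funD.
    exact/measurable_funM/measurable_funX.
  exact/measurable_funM.
rewrite ge0_integral_normal_prob; last 2 first.
  exact/measurable_EFinP.
  by move=> x; rewrite lee_fin expR_ge0.
set K := (X in _ = (_ * X)%:E).
have sD0 : Num.sqrt D != 0 by rewrite gt_eqF// sqrtr_gt0.
pose s' := s / Num.sqrt D; pose m' := (m + be * s ^+ 2) / D.
have s'0 : s' != 0 by rewrite mulf_neq0// invr_neq0.
have sqD : Num.sqrt D ^+ 2 = D by rewrite sqr_sqrtr// ltW.
have sE : s' ^+ 2 = s ^+ 2 / D by rewrite /s' exprMn exprVn sqD.
have H x : expR (al * x ^+ 2 + be * x) * normal_pdf m s x =
    (Num.sqrt D)^-1 * K * normal_pdf m' s' x.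
  rewrite !normal_pdfE// /normal_fun.
  have -> : normal_peak s = (Num.sqrt D)^-1 * normal_peak s'.
    rewrite /normal_peak sE -invfM -sqrtrM ?ltW//; congr (Num.sqrt _)^-1.
    by field; rewrite gt_eqF.
  rewrite mulrCA -!mulrA; congr (_ * _); rewrite [RHS]mulrCA; congr (_ * _).
  rewrite /K -!expRD; congr expR; rewrite sE /m' /D; field.
  by rewrite s0 -/D gt_eqF.
under eq_integral do rewrite -EFinM H EFinM.
rewrite ge0_integralZl//; last 3 first.
- apply/measurable_EFinP; exact: measurable_normal_pdf.
- by move=> x _; rewrite lee_fin normal_pdf_ge0.
- by rewrite lee_fin mulr_ge0 ?invr_ge0// expR_ge0.
by rewrite integral_normal_pdf mule1.
Qed.

Variables (d : measure_display) (Omega : measurableType d) (P : probability Omega R).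

Lemma integral_gaussian_exp_quad (f : {RV P >-> R}) (m s al be : R) :
  gaussian_law P f m s -> 2 * al * s ^+ 2 < 1 ->
  let D := 1 - 2 * al * s ^+ 2 in
  (\int[P]_w (expR (al * f w ^+ 2 + be * f w))%:E
   = ((Num.sqrt D)^-1 *
       expR ((al * m ^+ 2 + be * m + be ^+ 2 * s ^+ 2 / 2) / D))%:E)%E.
Proof.
move=> law sD D.
have mexp : measurable_fun setT (fun x : R => expR (al * x ^+ 2 + be * x)).
  apply: measurableT_comp => //; apply: measurable_funD.
    exact/measurable_funM/measurable_funX.
  exact/measurable_funM.
have mE := @measurable_EFinP _ _ _ setT (fun x : R => expR (al * x ^+ 2 + be * x)).
rewrite -(@ge0_integral_distribution _ _ _ _ _ P f
  (fun x => (expR (al * x ^+ 2 + be * x))%:E)); last 2 first.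
  exact/mE.
  by move=> x; rewrite lee_fin expR_ge0.
have [s0|s0] := eqVneq s 0.
  rewrite (@eq_measure_integral _ _ _ _ (dirac m)); last first.
    by move=> A mA _; have := law A mA; rewrite s0 eqxx.
  rewrite integral_dirac//; last exact/mE.
  rewrite diracT mul1e /D s0; congr (_%:E).
  by rewrite expr0n/= !mulr0 subr0 sqrtr1 invr1 mul1r mul0r addr0 mulr1.
rewrite -(integral_normal_exp_quad m be s0 sD).
(* [normal_prob] and random variables use two copies of the Borel sigma-algebra
   with different displays. *)
have mid : @measurable_fun _ default_measure_display (measurableTypeR R) R setT id.
  by move=> _ B mB; rewrite setTI.
pose X0 : {RV (normal_prob m s) >-> R} :=
  @mfun_Sub _ default_measure_display (measurableTypeR R) R id (mem_set mid).
rewrite (@eq_measure_integral _ _ _ _ (distribution (normal_prob m s) X0)); last first.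
  by move=> A mA _; have := law A mA; rewrite (negbTE s0).
rewrite (@ge0_integral_distribution _ _ _ _ _ (normal_prob m s) X0
  (fun x => (expR (al * x ^+ 2 + be * x))%:E))//; exact/mE.
Qed.

End GaussianIntegrals.

(** A Taylor bound of second order at 0, with the true coefficient 3/8 of [u^2] rounded up to 1/2.
    It serves to read a variance off the Laplace transform of a squared Gaussian variable. *)
Lemma invr_sqrt1D_le (R : realType) (u : R) : 0 <= u <= 1 ->
  (Num.sqrt (1 + u))^-1 <= 1 - u / 2 + u ^+ 2 / 2.
Proof.
move=> /andP[u0 u1].
have r0 : 0 < 1 - u / 2 + u ^+ 2 / 2 by nra.
have s0 : 0 < Num.sqrt (1 + u) by rewrite sqrtr_gt0; lra.
rewrite -(ler_pM2r s0) mulVf ?gt_eqF//.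
rewrite -(@ler_pXn2r _ 2)// ?nnegrE ?mulr_ge0// ?(ltW r0)//.
rewrite exprMn expr1n sqr_sqrtr; last lra.
have : 0 <= u ^+ 2 * (1 + 4 * (1 - u)) by rewrite mulr_ge0 ?sqr_ge0//; lra.
have : 0 <= u ^+ 3 * (1 - u) by rewrite mulr_ge0 ?exprn_ge0//; lra.
have : 0 <= u ^+ 5 by rewrite exprn_ge0.
have : 0 <= u ^+ 3 by rewrite exprn_ge0.
set h := _ * (1 + u).
have -> : h = 1 + u ^+ 2 / 4 + u ^+ 3 * 3 / 4 - u ^+ 4 / 4 + u ^+ 5 / 4.
  by rewrite /h; field.
have -> : u ^+ 3 * (1 - u) = u ^+ 3 - u ^+ 4 by ring.
have : 0 <= u ^+ 2 by rewrite sqr_ge0.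
lra.
Qed.

Section Subgaussian.
Variables (R : realType) (d : measure_display) (Omega : measurableType d).
Variable P : probability Omega R.

(** [gaussian] only asserts that parameters [m] and [s] exist. They are tied to the first two
    moments by integrating [1 + y <= exp y] and comparing with the closed form of the exponential
    integrals; [m = 0] and [s^2 <= v] suffice for the bound. *)
Lemma gaussian_mgf_le (f : {RV P >-> R}) (v : R) : gaussian P f ->
  'E_P[f]%E = 0%E -> (\int[P]_w (f w ^+ 2)%:E = v%:E)%E ->
  (\int[P]_w (expR (f w))%:E <= (expR (v / 2))%:E)%E.
Proof.
move=> [m [s [s0 law]]] Ef0 Ef2.
have mf : measurable_fun setT f by [].
have mf2 : measurable_fun setT (fun w => f w ^+ 2) by exact: measurable_funX.
have if2 : P.-integrable setT (fun w => (f w ^+ 2)%:E).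
  apply/integrableP; split; first exact/measurable_EFinP.
  under eq_integral do rewrite gee0_abs ?lee_fin ?sqr_ge0//.
  by rewrite Ef2 ltry.
have i1 : P.-integrable setT (cst 1%E : Omega -> \bar R).
  exact: finite_measure_integrable_cst.
have if1 : P.-integrable setT (EFin \o f).
  apply: (@le_integrable _ _ _ _ _ _ _ (fun w => 1 + (f w ^+ 2)%:E)%E) => //.
  - exact/measurable_EFinP.
  - move=> w _ /=; rewrite lee_fin [leRHS]ger0_norm ?addr_ge0 ?sqr_ge0//.
    have := sqr_ge0 (`|f w| - 1); rewrite -(@real_normK _ (f w)) ?num_real//.
    have := normr_ge0 (f w); nra.
  - exact: integrableD.
have v0 : 0 <= v.
  by rewrite -lee_fin -Ef2; apply: integral_ge0 => w _; rewrite lee_fin sqr_ge0.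
(* The integral of [c0 * f^2 + be * f + 1] is [c0 * v + 1]. The claim is applied with [c0 = al],
   where the second alternative is absurd. *)
have lower (c0 al be : R) : 2 * al * s ^+ 2 < 1 ->
    c0 * v <= (Num.sqrt (1 - 2 * al * s ^+ 2))^-1 *
       expR ((al * m ^+ 2 + be * m + be ^+ 2 * s ^+ 2 / 2) / (1 - 2 * al * s ^+ 2)) - 1
    \/ (exists x : R, al * x ^+ 2 + be * x < c0 * x ^+ 2 + be * x).
  move=> H; have [|hx] := pselect (exists x : R,
      al * x ^+ 2 + be * x < c0 * x ^+ 2 + be * x); first by right.
  left; rewrite lerBrDr -lee_fin -(integral_gaussian_exp_quad be law H).
  have -> : (c0 * v + 1)%:E =
      (\int[P]_w (c0%:E * (f w ^+ 2)%:E + (be%:E * (f w)%:E + 1)))%E.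
    rewrite integralD//; last 2 first.
      exact: integrableZl.
      by apply: integrableD => //; exact: integrableZl.
    rewrite integralZl// Ef2 integralD//; last exact: integrableZl.
    rewrite integralZl//; move: Ef0; rewrite unlock => ->.
    rewrite mule0 add0e integral_cst//. rewrite EFinD EFinM; congr (_ + _)%E.
    by rewrite mul1e; exact/esym/probability_setT.
  apply: le_integral => //.
  - apply: integrableD => //; first exact: integrableZl.
    by apply: integrableD => //; exact: integrableZl.
  - apply/integrableP; split.
      apply/measurable_EFinP; apply: measurableT_comp => //.
      by apply: measurable_funD; exact: measurable_funM.
    under eq_integral do rewrite gee0_abs ?lee_fin ?expR_ge0//.
    by rewrite (integral_gaussian_exp_quad be law H) ltry.
  - move=> w _; rewrite lee_fin.
    rewrite (le_trans _ (expR_ge1Dx _))//.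
    have : c0 * f w ^+ 2 + be * f w <= al * f w ^+ 2 + be * f w.
      by rewrite leNgt; apply/negP => h; apply: hx; exists (f w).
    lra.
(* [1 + t * 'E f <= E (expR (t * f)) = expR (t * m + (t * s) ^+ 2 / 2)] for all t *)
have m0 : m = 0.
  (* At this [t] the exponent [t * m + t^2 * s^2 / 2] is negative unless [m = 0]; the [+ 1] covers
     [s = 0]. *)
  pose t := - m / (s ^+ 2 + 1).
  have s10 : 0 < s ^+ 2 + 1 by rewrite ltr_wpDl// sqr_ge0.
  have H0 : 2 * 0 * s ^+ 2 < 1 by rewrite mulr0 mul0r.
  have [|[x]] := lower 0 0 t H0; last by rewrite ltxx.
  rewrite !mul0r mulr0 mul0r subr0 sqrtr1 invr1 mul1r add0r mulr1 subr_ge0.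
  rewrite -[leLHS]expR0 ler_expR => h.
  have : 0 <= (t * m + t ^+ 2 * s ^+ 2 / 2) * (s ^+ 2 + 1) ^+ 2.
    by rewrite mulr_ge0 ?sqr_ge0.
  have -> : (t * m + t ^+ 2 * s ^+ 2 / 2) * (s ^+ 2 + 1) ^+ 2 =
      - (m ^+ 2 * (s ^+ 2 / 2 + 1)).
    by rewrite /t; field; rewrite gt_eqF.
  rewrite oppr_ge0 pmulr_lle0; last by rewrite ltr_wpDl// divr_ge0 ?sqr_ge0.
  by move=> h2; apply/eqP; rewrite -sqrf_eq0 eq_le h2 sqr_ge0.
(* [1 - h * v / 2 <= E (expR (- h * f ^+ 2 / 2)) = (1 + h * s ^+ 2) ^ (- 1 / 2)],
   for small h *)
have sv : s ^+ 2 <= v.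
  rewrite leNgt; apply/negP => vs.
  have s20 : 0 < s ^+ 2 by exact: le_lt_trans vs.
  have sn0 : s != 0 by rewrite -sqrf_eq0 gt_eqF.
  (* With [u = h * s^2 = (1 - v / s^2) / 2] the comparison becomes [u * (1 - v / s^2) <= u^2], that
     is [2 * u^2 <= u^2], although [u > 0]. *)
  pose h := (s ^+ 2 - v) / (s ^+ 2) ^+ 2 / 2.
  have h0 : 0 < h by rewrite !divr_gt0 ?subr_gt0// exprn_gt0.
  have H : 2 * (- (h / 2)) * s ^+ 2 < 1.
    rewrite (le_lt_trans _ ltr01)// mulrN mulNr oppr_le0.
    by rewrite mulr_ge0// ?(ltW s20)// mulr_ge0// divr_ge0// ltW.
  have [|[x]] := lower (- (h / 2)) (- (h / 2)) 0 H; last by rewrite ltxx.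
  rewrite m0 expr0n/= !(mulr0, mul0r, addr0) expR0 mulr1.
  have hs : h * s ^+ 2 = (1 - v / s ^+ 2) / 2 by rewrite /h; field.
  have vs1 : v / s ^+ 2 <= 1 by rewrite ler_pdivrMr// mul1r ltW.
  have vs0 : 0 <= v / s ^+ 2 by rewrite divr_ge0// ltW.
  have -> : 1 - 2 * - (h / 2) * s ^+ 2 = 1 + h * s ^+ 2 by field.
  have /invr_sqrt1D_le : 0 <= h * s ^+ 2 <= 1 by rewrite hs; lra.
  have hv : h * v = h * s ^+ 2 * (v / s ^+ 2) by field.
  rewrite hs in hv *.
  set a := v / s ^+ 2 in hs vs0 vs1 hv *; set r := (Num.sqrt _)^-1 => h1 h2.
  have a1 : a < 1 by rewrite ltr_pdivrMr// mul1r.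
  nra.
have H0 : 2 * 0 * s ^+ 2 < 1 by rewrite mulr0 mul0r.
have /= := integral_gaussian_exp_quad 1 law H0.
under eq_integral do rewrite mul0r add0r mul1r.
move=> ->; rewrite lee_fin m0 !(mulr0, mul0r) subr0 sqrtr1 invr1 mul1r !add0r.
by rewrite mulr1 expr1n mul1r ler_expR ler_pM2r.
Qed.

(** The squares are introduced one at a time: each is replaced by a random linear term, which the
    bound for linear forms can take in. The input is thus a bound on exponential moments of linear
    combinations alone. *)
Lemma subgaussian_exp_quad (xi : nat -> Omega -> R) (l sk : nat -> R) (N : nat) :
  (forall k, measurable_fun setT (xi k)) ->
  (forall k, 0 <= l k) -> (forall k, 0 <= sk k) ->
  (forall k, sk k * l k <= 1 / 4) ->
  (forall c : nat -> R,
    (\int[P]_w (expR (\sum_(0 <= k < N) c k * xi k w))%:E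
      <= (expR (\sum_(0 <= k < N) c k ^+ 2 * l k / 2))%:E)%E) ->
  (\int[P]_w (expR (\sum_(0 <= k < N) sk k * xi k w ^+ 2))%:E
      <= (expR (\sum_(0 <= k < N) 2 * (sk k * l k)))%:E)%E.
Proof.
move=> mxi l0 sk0 skl mgf.
(* The induction needs an arbitrary linear part [c], since the auxiliary variable of step [n] is
   merged into [c n]. Treating the square at [k] raises the factor of [c k ^+ 2 * l k] from 1/2 to
   1. *)
suff H : forall n : nat, (n <= N)%N -> forall c : nat -> R,
  (\int[P]_w (expR (\sum_(0 <= k < n) sk k * xi k w ^+ 2 +
                    \sum_(0 <= k < N) c k * xi k w))%:E
    <= (expR (\sum_(0 <= k < n) 2 * (sk k * l k) +
              \sum_(0 <= k < N) c k ^+ 2 * l k *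
                (if (k < n)%N then 1 else 2^-1)))%:E)%E.
  have := H N (leqnn N) (fun=> 0).
  have E0 w : \sum_(0 <= k < N) 0 * xi k w = 0 by rewrite big1// => *; rewrite mul0r.
  under eq_integral do rewrite E0 addr0.
  by rewrite [X in expR (_ + X)]big1 ?addr0// => k _; rewrite expr0n/= !mul0r.
have mlin (c : nat -> R) :
    measurable_fun setT (fun w => \sum_(0 <= k < N) c k * xi k w).
  by apply: measurable_sum => k; exact: measurable_funM.
have mquad n : measurable_fun setT (fun w => \sum_(0 <= k < n) sk k * xi k w ^+ 2).
  apply: measurable_sum => k; apply: measurable_funM => //.
  exact: measurable_funX.
elim=> [_ c|n IH nN c].
  under eq_integral do rewrite big_geq// add0r.
  rewrite (le_trans (mgf c))// lee_fin ler_expR [X in _ <= X + _]big_geq// add0r.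
  by apply: ler_sum => k _; rewrite ltn0.
pose r := Num.sqrt (2 * sk n).
have r2 : r ^+ 2 = 2 * sk n by rewrite sqr_sqrtr// mulr_ge0.
pose c' g k := c k + (k == n)%:R * (r * g).
have c'E g w : \sum_(0 <= k < N) c' g k * xi k w =
    \sum_(0 <= k < N) c k * xi k w + r * g * xi n w.
  under eq_bigr do rewrite mulrDl; rewrite big_split/=; congr (_ + _).
  rewrite (bigD1_seq n)/= ?iota_uniq ?mem_index_iota//.
  rewrite eqxx mul1r big1 ?addr0// => k /negbTE ->.
  by rewrite !mul0r.
pose A w := \sum_(0 <= k < n) sk k * xi k w ^+ 2 + \sum_(0 <= k < N) c k * xi k w.
have mA : measurable_fun setT A by exact: measurable_funD.
have step w : (expR (\sum_(0 <= k < n.+1) sk k * xi k w ^+ 2 +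
                    \sum_(0 <= k < N) c k * xi k w))%:E =
    (\int[normal_prob 0 1]_g (expR (A w + r * g * xi n w))%:E)%E.
  transitivity ((expR (A w))%:E * \int[normal_prob 0 1]_g
      (expR (0 * g ^+ 2 + (r * xi n w) * g))%:E)%E; last first.
    rewrite -ge0_integralZl//.
    - apply: eq_integral => g _; rewrite -EFinM -expRD mul0r add0r.
      by rewrite (mulrAC r).
    - apply/measurable_EFinP; apply: measurableT_comp => //.
      by apply: measurable_funD; exact: measurable_funM.
  have H01 : (2 : R) * 0 * 1 ^+ 2 < 1 by rewrite mulr0 mul0r.
  rewrite (integral_normal_exp_quad 0 _ (oner_neq0 R) H01).
  rewrite -EFinM; congr (_%:E).
  rewrite mulr0 mul0r subr0 sqrtr1 invr1 mul1r -expRD; congr expR.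
  rewrite /A big_nat_recr//= exprMn r2; by field.
under eq_integral do rewrite step.
rewrite (@fubini_tonelli _ _ _ _ _ P (normal_prob 0 1)
   (fun p => (expR (A p.1 + r * p.2 * xi n p.1))%:E)); last 2 first.
  apply/measurable_EFinP; apply: measurableT_comp => //.
  apply: measurable_funD; first exact: measurableT_comp.
  apply: measurable_funM; first exact: measurable_funM.
  exact: measurableT_comp.
  by move=> p; rewrite lee_fin expR_ge0.
set B := \sum_(0 <= k < n) 2 * (sk k * l k) +
  \sum_(0 <= k < N | k != n) c k ^+ 2 * l k * (if (k < n)%N then 1 else 2^-1).
apply: (@le_trans _ _ (\int[normal_prob 0 1]_g
    ((expR (B + c n ^+ 2 * l n / 2))%:E *
     (expR (l n * sk n * g ^+ 2 + (c n * l n * r) * g))%:E))%E).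
  apply: ge0_le_integral => //.
  - by move=> g _; apply: integral_ge0 => w _; rewrite lee_fin expR_ge0.
  - apply: (@measurable_fun_fubini_tonelli_G _ _ _ _ _ P
      (fun p => (expR (A p.1 + r * p.2 * xi n p.1))%:E)).
      apply/measurable_EFinP; apply: measurableT_comp => //.
      apply: measurable_funD; first exact: measurableT_comp.
      apply: measurable_funM; first exact: measurable_funM.
      exact: measurableT_comp.
    by move=> p; rewrite lee_fin expR_ge0.
  - apply: measurable_funeM; apply/measurable_EFinP; apply: measurableT_comp => //.
    apply: measurable_funD; last exact: measurable_funM.
    exact/measurable_funM/measurable_funX.
  - move=> g _; have := IH (ltnW nN) (c' g).
    under eq_integral do rewrite c'E addrA.
    move=> /le_trans; apply; rewrite -EFinM -expRD lee_fin ler_expR.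
    rewrite [X in _ + X <= _](bigD1_seq n)/= ?iota_uniq ?mem_index_iota//.
    rewrite ltnn /c' eqxx.
    rewrite /B -!addrA lerD2l.
    rewrite [X in _ + X <= _](_ : _ = \sum_(0 <= k < N | k != n)
        c k ^+ 2 * l k * (if (k < n)%N then 1 else 2^-1)); last first.
      by apply: eq_bigr => k /negbTE ->; rewrite mul0r addr0.
    rewrite [leLHS]addrC lerD2l mul1r.
    rewrite le_eqVlt; apply/orP; left; apply/eqP.
    have -> : l n * sk n = l n * r ^+ 2 / 2 by rewrite r2; field.
    by field.
rewrite ge0_integralZl//; last first.
  apply/measurable_EFinP; apply: measurableT_comp => //.
  apply: measurable_funD; last exact: measurable_funM.
  exact/measurable_funM/measurable_funX.
set a := sk n * l n.
have a0 : 0 <= a by rewrite mulr_ge0.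
have a4 : a <= 1 / 4 := skl n.
have Ha : 2 * (l n * sk n) * 1 ^+ 2 < 1.
  by rewrite expr1n mulr1 (mulrC (l n)) -/a; lra.
rewrite (integral_normal_exp_quad 0 _ (oner_neq0 R) Ha).
rewrite expr1n !mulr1 mulr0 addr0 expr0n/= mulr0 add0r (mulrC (l n)) -/a.
rewrite -EFinM lee_fin.
have D0 : 0 < 1 - 2 * a by lra.
(* After squaring this follows from [(1 + 4 * a) * (1 - 2 * a) >= 1], which holds because
   [0 <= a <= 1 / 4]. The same bound on [a] gives [a / (1 - 2 * a) <= 1 / 2], the increase of the
   linear factor allowed in the induction. *)
have D2 : (Num.sqrt (1 - 2 * a))^-1 <= expR (2 * a).
  have s0 : 0 < Num.sqrt (1 - 2 * a) by rewrite sqrtr_gt0.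
  rewrite -(ler_pM2r s0) mulVf ?gt_eqF//.
  rewrite -(@ler_pXn2r _ 2)// ?nnegrE ?mulr_ge0// ?expR_ge0//.
  rewrite exprMn expr1n sqr_sqrtr; last lra.
  rewrite -expRM_natl.
  have := expR_ge1Dx (2 * (2 * a)) => h.
  rewrite (@le_trans _ _ ((1 + 2 * (2 * a)) * (1 - 2 * a)))//.
    have : 0 <= a * (1 / 4 - a) by rewrite mulr_ge0// subr_ge0.
    move=> h4; nra.
  rewrite ler_wpM2r//; lra.
rewrite mulrCA (le_trans (ler_wpM2r _ D2)) ?mulr_ge0 ?expR_ge0//.
rewrite -!expRD ler_expR.
rewrite (@big_nat_recr _ _ _ n)//= -/a.
rewrite [X in _ <= _ + X](bigD1_seq n)/= ?iota_uniq ?mem_index_iota//.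
rewrite ltnSn mulr1.
rewrite [X in _ <= _ + (_ + X)](_ : _ = \sum_(0 <= k < N | k != n)
    c k ^+ 2 * l k * (if (k < n)%N then 1 else 2^-1)); last first.
  by apply: eq_bigr => k kn; rewrite ltnS leq_eqVlt (negbTE kn).
rewrite /B; set B1 := \sum_(0 <= k < n) _; set B2 := \sum_(_ <= _ < _ | _) _.
have -> : (c n * l n * r) ^+ 2 = 2 * a * (c n ^+ 2 * l n).
  by rewrite !exprMn r2 /a; ring.
have c0 : 0 <= c n ^+ 2 * l n by rewrite mulr_ge0 ?sqr_ge0.
have : 2 * a * (c n ^+ 2 * l n) / 2 / (1 - 2 * a) <= c n ^+ 2 * l n / 2.
  by rewrite ler_pdivrMr//; nra.
lra.
Qed.

End Subgaussian.

Lemma measurable_fcalc_sqnorm (R : realType) (X : completeNormedModType R)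
    (ip : {dot X for idfun}) (hip : induces_norm ip) (e : nat -> X)
    (he : orthonormal_basis ip e) (lam : nat -> R) (phi : R -> R) (M : R)
    (phiM : forall k, `|phi (lam k)| <= M)
    (d : measure_display) (Omega : measurableType d) (W : Omega -> X) :
  (forall U : set X, open U -> measurable (W @^-1` U)) ->
  measurable_fun setT (fun w => `|fcalc ip e lam phi (W w)| ^+ 2).
Proof.
move=> mW.
apply: (@measurable_fun_cvg _ _ _ _
  (fun n w => series (fun k => (phi (lam k) * ip (W w) (e k)) ^+ 2) n)).
  move=> n; rewrite /series/=; apply: measurable_sum => k.
  apply: measurable_funX; apply: measurable_funM => //.
  exact: measurable_ip.
by move=> w _; exact: (fcalc_norm hip he phiM).
Qed.

(** * The noise in the eigenbasis *)

Section Noise.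
Variables (R : realType) (d : measure_display) (Omega : measurableType d).
Variables (P : probability Omega R) (X Y : completeNormedModType R).
Variables (ipX : {dot X for idfun}) (ipY : {dot Y for idfun}).
Hypothesis hipX : induces_norm ipX.
Variables (T : {linear X -> Y}) (Tadj : Y -> X).
Hypothesis hTadj : is_adjoint ipX ipY T Tadj.
Variables (e : nat -> X) (lam : nat -> R).
Hypothesis heig : eigensystem ipX (Tadj \o T) e lam.
Variable Z : Y -> {RV P >-> R}.
Hypothesis hZ : standard_gaussian_process ipY Z.
Variable TZ : Omega -> X.
Hypothesis hTZ : adjoint_version P ipX T Z TZ.

Let he : orthonormal_basis ipX e. Proof. by case: heig. Qed.
Let lam0 k : 0 < lam k. Proof. by case: heig. Qed.

Lemma adjoint_coef x k : ipX (Tadj (T x)) (e k) = lam k * ipX x (e k).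
Proof.
case: heig => _ Ae _ _ _.
by rewrite ipC -hTadj ipC hTadj -[Tadj _]/((Tadj \o T) (e k)) Ae ipZr ipC.
Qed.

Lemma gaussian_noise y : gaussian P (Z y).
Proof.
case: hZ => /(_ 1%N (fun=> 1) (fun=> y)) + _ _.
suff -> : (fun w => \sum_(i < 1) 1 * Z y w) = Z y by [].
by apply/funext => w; rewrite big_ord1 mul1r.
Qed.

Lemma noise_mgf_le x :
  (\int[P]_w (expR (ipX (TZ w) x))%:E <= (expR (ipY (T x) (T x) / 2))%:E)%E.
Proof.
have [mTZ /(_ x) aeTZ] := hTZ.
have -> : (\int[P]_w (expR (ipX (TZ w) x))%:E = \int[P]_w (expR (Z (T x) w))%:E)%E.
  apply: ge0_ae_eq_integral => //.
  - apply/measurable_EFinP; apply: measurableT_comp => //.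
    exact: measurable_ip.
  - by apply/measurable_EFinP; apply: measurableT_comp.
  - case: aeTZ => N [mN N0 sub]; exists N; split => // w /= nw.
    by apply: sub => /= h; apply: nw => _; rewrite h.
have [_ EZ covZ] := hZ.
apply: gaussian_mgf_le => //; first exact: gaussian_noise.
rewrite -covZ unlock EZ/= unlock; apply: eq_integral => w _.
rewrite (_ : ((Z (T x) \- cst 0) * (Z (T x) \- cst 0)) w =
  (Z (T x) w - 0) * (Z (T x) w - 0))// subr0.
by rewrite expr2.
Qed.

(** The sum is [<TZ, x>] with [x = sum_k c_k e_k], and its variance [|T x|^2 = <x, T^* T x>] is
    diagonal because the [e k] are eigenvectors. *)
Lemma noise_mgf_sum_le N (c : nat -> R) :
  (\int[P]_w (expR (\sum_(0 <= k < N) c k * ipX (TZ w) (e k)))%:E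
    <= (expR (\sum_(0 <= k < N) c k ^+ 2 * lam k / 2))%:E)%E.
Proof.
pose x := \sum_(0 <= k < N) c k *: e k.
have := noise_mgf_le x.
under eq_integral => w _.
  rewrite (ipC ipX) (ip_suml ipX).
  under eq_bigr do rewrite (ipZl ipX) (ipC ipX).
  over.
move/le_trans; apply; rewrite lee_fin ler_expR -mulr_suml ler_pM2r//.
rewrite hTadj (ip_suml ipX) ler_sum_nat// => k kN.
rewrite (ipZl ipX) (ipC ipX) adjoint_coef (ip_psum he) kN.
by rewrite expr2 -mulrA [lam k * _]mulrC.
Qed.

Variables (phi : R -> R) (M A V : R).
Hypothesis phiM : forall k, `|phi (lam k)| <= M.
Hypothesis A0 : 0 < A.
Hypothesis phiA : forall k, lam k * phi (lam k) ^+ 2 <= A.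
Hypothesis phiV : forall N, \sum_(0 <= k < N) lam k * phi (lam k) ^+ 2 <= V.

Let D w := `|fcalc ipX e lam phi (TZ w)| ^+ 2.

Lemma fcalc_noise_exp_moment :
  (\int[P]_w (expR (D w / (4 * A)))%:E <= (expR (V / (2 * A)))%:E)%E.
Proof.
have [mTZ _] := hTZ.
(* The scale [4 * A] is dictated by the condition [sk k * lam k <= 1 / 4]. The finite sums then
   increase to [D w / (4 * A)], and monotone convergence applies. *)
pose sk k := phi (lam k) ^+ 2 / (4 * A).
have A40 : 0 < 4 * A by rewrite mulr_gt0.
have sk0 k : 0 <= sk k by rewrite divr_ge0 ?sqr_ge0// ltW.
pose g N w := (expR (\sum_(0 <= k < N) sk k * ipX (TZ w) (e k) ^+ 2))%:E.
have mip k : measurable_fun setT (fun w => ipX (TZ w) (e k)) by exact: measurable_ip.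
have gD w : limn (g ^~ w) = (expR (D w / (4 * A)))%:E.
  apply/cvg_lim => //; apply: cvg_EFin; first by near=> n.
  rewrite [fine \o _](_ : _ = (fun n => expR
      (series (fun k => (phi (lam k) * ipX (TZ w) (e k)) ^+ 2) n / (4 * A)))); last first.
    apply/funext => n /=; congr expR; rewrite /series/= mulr_suml.
    by apply: eq_bigr => k _; rewrite exprMn /sk mulrAC.
  apply: (@cvg_comp _ _ _ (fun n => series (fun k =>
    (phi (lam k) * ipX (TZ w) (e k)) ^+ 2) n / (4 * A)) expR);
    last exact: continuous_expR.
  apply: cvgM; last exact: cvg_cst.
  exact: (fcalc_norm hipX he phiM).
under eq_integral do rewrite -gD.
rewrite monotone_convergence//; last 3 first.
- move=> n; apply/measurable_EFinP; apply: measurableT_comp => //.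
  apply: measurable_sum => k; apply: measurable_funM => //.
  exact: measurable_funX.
- by move=> n w _; rewrite lee_fin expR_ge0.
- move=> w _ m n mn; rewrite lee_fin ler_expR.
  rewrite (big_cat_nat (leq0n m) mn)//= lerDl sumr_ge0// => k _.
  by rewrite mulr_ge0 ?sqr_ge0.
apply: lime_le.
  apply: ereal_nondecreasing_is_cvgn => m n mn; apply: ge0_le_integral => //.
  - by move=> w _; rewrite lee_fin expR_ge0.
  - apply/measurable_EFinP; apply: measurableT_comp => //.
    apply: measurable_sum => k; apply: measurable_funM => //.
    exact: measurable_funX.
  - apply/measurable_EFinP; apply: measurableT_comp => //.
    apply: measurable_sum => k; apply: measurable_funM => //.
    exact: measurable_funX.
  - move=> w _; rewrite lee_fin ler_expR.
    rewrite (big_cat_nat (leq0n m) mn)//= lerDl sumr_ge0// => k _.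
    by rewrite mulr_ge0 ?sqr_ge0.
apply: nearW => N.
have skE k : sk k * lam k = lam k * phi (lam k) ^+ 2 / (4 * A).
  by rewrite /sk mulrAC [_ * lam k]mulrC.
have := @subgaussian_exp_quad _ _ _ P (fun k w => ipX (TZ w) (e k)) lam sk N mip
  (fun k => ltW (lam0 k)) sk0.
move=> /(_ _ (noise_mgf_sum_le N)) h; apply: (le_trans (h _)).
  move=> k; rewrite skE ler_pdivrMr//.
  by rewrite (le_trans (phiA k))//; lra.
rewrite lee_fin ler_expR.
under eq_bigr do rewrite skE mulrA.
rewrite -mulr_suml -mulr_sumr.
rewrite ler_pdivrMr//.
rewrite (@le_trans _ _ (2 * V))//; first by rewrite ler_pM2l.
by rewrite le_eqVlt; apply/orP; left; apply/eqP; field; rewrite gt_eqF.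
Unshelve. all: by end_near.
Qed.

End Noise.

(** * Exponential eigenvalue decay and the rate *)

Section Asymptotics.
Variable R : realType.
Implicit Types (x y : R).

Lemma powR_expR_ln x r : 0 < x -> x `^ r = expR (r * ln x).
Proof. by move=> x0; rewrite /powR gt_eqF. Qed.

(** The tangent of the concave function [ln] at [1 / t]; the slope [t] is left free so that a
    logarithm can be absorbed by an arbitrarily small multiple of its argument. *)
Lemma ln_le_mul_sub x t : 0 < x -> 0 < t -> ln x <= x * t - 1 - ln t.
Proof.
move=> x0 t0.
have -> : ln x = ln (x * t) - ln t by rewrite lnM ?posrE// addrK.
rewrite lerD2r.
have xt : 0 < x * t by rewrite mulr_gt0.
rewrite [in leLHS](_ : x * t = 1 + (x * t - 1)); last by rewrite addrC subrK.
by rewrite le_ln1Dx//; lra.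
Qed.

(** The tangent of slope [c / p'] turns [p' * ln y] into [c * y] plus a constant. Replacing [p] by
    [p' = max p 1] covers nonpositive exponents. *)
Lemma powR_expRN_bounded (p c : R) : 0 < c ->
  exists2 K, 0 < K & forall y, 1 <= y -> y `^ p * expR (- (c * y)) <= K.
Proof.
move=> c0; pose p' := Num.max p 1.
have p'0 : 0 < p' by rewrite lt_max ltr01 orbT.
exists (expR (- p' - p' * ln (c / p'))); first exact: expR_gt0.
move=> y y1; have y0 : 0 < y by exact: lt_le_trans y1.
rewrite powR_expR_ln// -expRD ler_expR.
have lny0 : 0 <= ln y by rewrite ln_ge0.
have h1 : p * ln y <= p' * ln y by rewrite ler_wpM2r// le_max lexx.
have /(ler_wpM2l (ltW p'0)) := @ln_le_mul_sub y (c / p') y0 (divr_gt0 c0 p'0).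
have -> : p' * (y * (c / p') - 1 - ln (c / p')) = c * y - p' - p' * ln (c / p').
  by field; rewrite gt_eqF.
lra.
Qed.

Lemma sum_lt_indicator_le (J : R) N : 0 <= J ->
  \sum_(0 <= k < N) (if k.+1%:R < J then 1 else 0) <= J.
Proof.
move=> J0.
suff : \sum_(0 <= k < N) (if k.+1%:R < J then 1 else 0) <= J /\
   \sum_(0 <= k < N) (if k.+1%:R < J then 1 else 0) <= N%:R :> R by case.
elim: N => [|N [IH1 IH2]]; first by rewrite big_geq.
rewrite big_nat_recr//=; case: ifPn => NJ.
  split; rewrite -?[N.+1%:R]natr1 ?lerD2r//.
  by rewrite (le_trans _ (ltW NJ))// -natr1 lerD2r.
by rewrite addr0; split => //; rewrite (le_trans IH2)// ler_nat.
Qed.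

Lemma sum_inv_sqr_le N : \sum_(0 <= k < N) (k.+1%:R ^+ 2)^-1 <= 2 :> R.
Proof.
case: N => [|N]; first by rewrite big_geq.
suff : \sum_(0 <= k < N.+1) (k.+1%:R ^+ 2)^-1 <= 2 - N.+1%:R^-1 :> R.
  by move=> /le_trans; apply; rewrite gerDl oppr_le0 invr_ge0.
elim: N => [|N IH]; first by rewrite big_nat1 mulr1n expr1n invr1; lra.
rewrite big_nat_recr//=.
have n0 : (0 : R) < N.+1%:R by rewrite ltr0n.
have m0 : (0 : R) < N.+2%:R by rewrite ltr0n.
have nm : N.+2%:R = N.+1%:R + 1 :> R by rewrite natr1.
suff : (N.+2%:R ^+ 2)^-1 <= N.+1%:R^-1 - N.+2%:R^-1 :> R.
  by move=> h; rewrite (le_trans (lerD IH h))// addrA subrK.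
rewrite nm in m0 *; set n := N.+1%:R in n0 m0 *.
have -> : n^-1 - (n + 1)^-1 = (n * (n + 1))^-1.
  by field; rewrite !gt_eqF.
rewrite lef_pV2 ?posrE ?mulr_gt0// expr2 ler_wpM2r ?(ltW m0)//; lra.
Qed.

Section EigenvalueDecay.
Variables (lam : nat -> R) (cmin cmax a b vartheta : R).
Hypothesis hc : 0 < cmin <= cmax.
Hypothesis hb : 0 < b.
Hypothesis hvartheta : 0 < vartheta <= 1 / 2.
Hypothesis hdecay : forall k : nat,
    cmin * k.+1%:R `^ (- a) * expR (- (b * k.+1%:R `^ vartheta)) <= lam k /\
    lam k <= cmax * k.+1%:R `^ (- a) * expR (- (b * k.+1%:R `^ vartheta)).

Let vt0 : 0 < vartheta. Proof. by case/andP: hvartheta. Qed.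

(** The decay is purely exponential in this variable, and every power of [k.+1] is a power of [y k],
    to be absorbed by a fraction of the exponent. *)
Let y k : R := k.+1%:R `^ vartheta.

Let y1 k : 1 <= y k.
Proof.
rewrite /y powR_expR_ln// -[leLHS]expR0 ler_expR mulr_ge0 ?(ltW vt0)// ln_ge0//.
by rewrite ler1n.
Qed.

Let powy k r : k.+1%:R `^ r = y k `^ (r / vartheta).
Proof. by rewrite /y -powRrM mulrC divfK// gt_eqF. Qed.

(** Three quarters of the exponent pay for [k.+1 ^ (2 - a)]. The remaining quarter tells from which
    index on [lam k] is of order [exp (- L)], and the factor [1 / k.+1 ^ 2] keeps the tail
    summable. *)
Lemma eigenvalue_upper : exists2 K, 0 < K &
  forall k, lam k <= K * expR (- (b / 4 * k.+1%:R `^ vartheta)) / k.+1%:R ^+ 2.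
Proof.
have b34 : 0 < 3 * b / 4 by rewrite divr_gt0// mulr_gt0.
have [K K0 HK] := powR_expRN_bounded ((2 - a) / vartheta) b34.
have c0 : 0 < cmax by case/andP: hc => c1 c2; exact: lt_le_trans c2.
exists (cmax * K) => [|k]; first exact: mulr_gt0.
have k0 : 0 < k.+1%:R :> R by [].
have [_ /le_trans] := hdecay k; apply.
rewrite ler_pdivlMr ?exprn_gt0// -/(y k).
have -> : cmax * k.+1%:R `^ (- a) * expR (- (b * y k)) * k.+1%:R ^+ 2 =
   cmax * (y k `^ ((2 - a) / vartheta) * expR (- (3 * b / 4 * y k)))
     * expR (- (b / 4 * y k)).
  rewrite -(powy k (2 - a)).
  have -> : k.+1%:R `^ (2 - a) = k.+1%:R ^+ 2 * k.+1%:R `^ (- a) :> R.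
    by rewrite -powR_mulrn// -powRD// (gt_eqF k0) implybT.
  have -> : expR (- (b * y k)) = expR (- (3 * b / 4 * y k)) * expR (- (b / 4 * y k)).
    by rewrite -expRD; congr expR; field.
  ring.
rewrite ler_wpM2r ?expR_ge0// ler_pM2l//; exact: HK.
Qed.

Lemma eigenvalue_lower : exists2 c, 0 < c &
  forall k, c * expR (- (2 * b * k.+1%:R `^ vartheta)) <= lam k.
Proof.
have [K K0 HK] := powR_expRN_bounded (a / vartheta) hb.
have c0 : 0 < cmin by case/andP: hc.
exists (cmin / K) => [|k]; first exact: divr_gt0.
have [/(le_trans _) + _] := hdecay k; apply.
rewrite (powy k (- a)) -/(y k) mulNr powRN.
have yp : 0 < y k `^ (a / vartheta) by rewrite powR_gt0// (lt_le_trans ltr01).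
have -> : expR (- (2 * b * y k)) = expR (- (b * y k)) * expR (- (b * y k)).
  by rewrite -expRD; congr expR; ring.
rewrite mulrA ler_wpM2r ?expR_ge0// -mulrA ler_pM2l//.
by rewrite ler_pdivrMl// ler_pdivlMr// mulrC HK.
Qed.

(** Here [Q k] stands for [q alpha (lam k)] and [L] for [- ln alpha]. The sum is cut at [J], of
    order [L ^ (1 / vartheta)]: below [J] each term is at most [Q k <= Cq / alpha], above it
    [lam k <= K * alpha / k.+1 ^ 2] compensates one of the two factors [1 / alpha] in [Q k ^+ 2]. *)
Lemma filter_variance_upper (Cq : R) : 0 <= Cq -> exists2 K, 0 < K &
  forall (Q : nat -> R) (L : R) N, 1 <= L ->
    (forall k, 0 < lam k) -> (forall k, 0 <= Q k) ->
    (forall k, expR (- L) * Q k <= Cq) -> (forall k, lam k * Q k <= 1) ->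
    \sum_(0 <= k < N) lam k * Q k ^+ 2 <= K * L `^ (vartheta^-1) * expR L.
Proof.
move=> Cq0; have [K K0 HK] := eigenvalue_upper.
have b4 : 0 < 4 / b by rewrite divr_gt0.
exists (Cq * (4 / b) `^ vartheta^-1 + Cq ^+ 2 * K * 2 + 1).
  by rewrite ltr_wpDl// addr_ge0// mulr_ge0 ?powR_ge0// mulr_ge0 ?sqr_ge0// ltW.
move=> Q L N L1 lam0 Q0 QC lamQ.
have L0 : 0 < L by exact: lt_le_trans L1.
pose J := (4 / b * L) `^ vartheta^-1.
have J0 : 0 <= J by exact: powR_ge0.
have QL k : Q k <= Cq * expR L.
  by have := QC k; rewrite expRN mulrC ler_pdivrMr ?expR_gt0.
have Lw : 1 <= L `^ vartheta^-1.
  by rewrite powR_expR_ln// -[leLHS]expR0 ler_expR mulr_ge0 ?invr_ge0 ?(ltW vt0)// ln_ge0.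
apply: (@le_trans _ _ (\sum_(0 <= k < N)
    (Cq * expR L * (if k.+1%:R < J then 1 else 0)
      + Cq ^+ 2 * K * expR L * (k.+1%:R ^+ 2)^-1))).
  apply: ler_sum => k _; case: ifPn => [_|].
    rewrite mulr1 (@le_trans _ _ (Cq * expR L))//; last first.
      by rewrite lerDl !mulr_ge0 ?sqr_ge0 ?expR_ge0 ?(ltW K0)// invr_ge0 sqr_ge0.
    rewrite expr2 mulrA (le_trans _ (QL k))// -[leRHS]mul1r ler_wpM2r//.
  rewrite -leNgt mulr0 add0r => Jk.
  have Ly : L <= b / 4 * k.+1%:R `^ vartheta.
    rewrite -ler_pdivrMl ?divr_gt0// invf_div.
    have : J `^ vartheta <= k.+1%:R `^ vartheta.
      by apply: ge0_ler_powR; rewrite ?nnegrE// ltW.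
    by rewrite /J -powRrM mulVf ?gt_eqF// powRr1// mulr_ge0 ?(ltW b4)// ltW.
  have lamk : lam k <= K * expR (- L) / k.+1%:R ^+ 2.
    rewrite (le_trans (HK k))// ler_wpM2r ?invr_ge0 ?sqr_ge0//.
    by rewrite ler_pM2l// ler_expR lerN2.
  rewrite (@le_trans _ _ (K * expR (- L) / k.+1%:R ^+ 2 * (Cq * expR L) ^+ 2))//.
    rewrite ler_pM ?sqr_ge0 ?(ltW (lam0 k))// ler_pXn2r ?nnegrE//.
    by rewrite mulr_ge0 ?expR_ge0.
  rewrite expRN le_eqVlt; apply/orP; left; apply/eqP; field.
  by rewrite nat1r !gt_eqF ?expR_gt0 ?ltr0n.
rewrite big_split/= -!mulr_sumr.
have := @sum_lt_indicator_le J N J0; have := @sum_inv_sqr_le N.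
set s1 := \sum_(_ <= _ < _) _; set s2 := \sum_(_ <= _ < _) _ => hs1 hs2.
have eL := expR_gt0 L.
rewrite mulrAC [X in _ + X]mulrAC -mulrDl ler_pM2r//.
rewrite (@le_trans _ _ (Cq * J + Cq ^+ 2 * K * 2))//.
  by rewrite lerD// ler_wpM2l// mulr_ge0 ?sqr_ge0// ltW.
rewrite /J powRM ?(ltW b4) ?(ltW L0)// !mulrDl mulrA.
rewrite -addrA lerD2l mul1r (@le_trans _ _ (Cq ^+ 2 * K * 2 * L `^ vartheta^-1))//.
  by rewrite ler_peMr// !mulr_ge0 ?sqr_ge0// ltW.
by rewrite lerDl (le_trans ler01).
Qed.

(** This is where [vartheta <= 1 / 2] enters: [k.+1 <= u^2] with [u >= 1] gives
    [k.+1 ^ vartheta <= u], so about [u^2] eigenvalues stay above [exp (- L)] for [u] proportional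
    to [L]. *)
Lemma eigenvalue_count_lower : exists2 L0, 1 <= L0 & exists2 c, 0 < c &
  forall L, L0 <= L -> exists2 n : nat, c * L ^+ 2 <= n%:R &
    forall k, (k < n)%N -> expR (- L) <= lam k.
Proof.
have [c c0 Hc] := eigenvalue_lower.
(* [8 * b] ensures [u >= 2], so that truncating [u^2] loses at most half of it; [- 2 * ln c] ensures
   [c >= exp (- L / 2)], and the other half of the exponent is left for the decay. *)
exists (Num.max 1 (Num.max (8 * b) (- 2 * ln c))).
  by rewrite le_max lexx.
have b0 : 0 < 4 * b by rewrite mulr_gt0.
exists ((4 * b) ^- 2 / 2); first by rewrite divr_gt0// invr_gt0 exprn_gt0.
move=> L; rewrite !ge_max => /and3P[L1 L8 Lc].
have L0 : 0 < L by exact: lt_le_trans L1.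
pose u := L / (4 * b).
have u2 : 2 <= u by rewrite ler_pdivlMr//; lra.
exists (Num.truncn (u ^+ 2)).
  have /andP[_] := truncn_itv (sqr_ge0 u).
  rewrite -natr1 => h; have : 4 <= u ^+ 2 by nra.
  have -> : (4 * b) ^- 2 / 2 * L ^+ 2 = u ^+ 2 / 2.
    by rewrite /u; field; rewrite gt_eqF.
  lra.
move=> k kn; apply: le_trans (Hc k).
have ku : k.+1%:R <= u ^+ 2.
  have /andP[h _] := truncn_itv (sqr_ge0 u).
  by rewrite (le_trans _ h)// ler_nat.
have yu : y k <= u.
  have u0 : 0 < u by lra.
  apply: (@le_trans _ _ ((u ^+ 2) `^ vartheta)).
    by apply: ge0_ler_powR; rewrite ?nnegrE ?sqr_ge0// ltW.
  rewrite powR_expR_ln ?exprn_gt0// lnXn// mulrnAr -[leRHS]lnK ?posrE// ler_expR.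
  have lnu : 0 <= ln u by rewrite ln_ge0//; lra.
  have : vartheta <= 1 / 2 by case/andP: hvartheta.
  rewrite -mulr_natr; nra.
rewrite -[c]lnK ?posrE// -expRD ler_expR -/(y k).
have : 2 * b * y k <= L / 2.
  have -> : L / 2 = 2 * b * u by rewrite /u; field; rewrite gt_eqF.
  by rewrite ler_pM2l//; lra.
lra.
Qed.

End EigenvalueDecay.
End Asymptotics.

(** * Balancing squared bias against variance *)

Section Rate.
Variables (R : realType) (nu tau : R).
Hypothesis hnutau : 0 < nu \/ (nu = 0 /\ 0 < tau).

(** [phi_log nu tau] in the variable [l = - ln x]. *)
Definition phi_exp (l : R) : R := expR (- (nu * l)) * l `^ (- tau).

Lemma phi_logE x : 0 < x -> phi_log nu tau x = phi_exp (- ln x).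
Proof.
move=> x0; rewrite /phi_log gt_eqF// /phi_exp powR_expR_ln//.
by rewrite mulrN opprK.
Qed.

Lemma phi_exp_ge0 l : 0 <= phi_exp l.
Proof. by rewrite mulr_ge0 ?expR_ge0 ?powR_ge0. Qed.

Let nu0 : 0 <= nu. Proof. by case: hnutau => [/ltW//|[-> _]]. Qed.

(** For [tau < 0] the power of [l] increases and monotonicity can fail. Since
    [l' <= (1 + (l' - l)) * l] for [l >= 1], the growth of the power is controlled by [l' - l] and
    beaten by the exponential, [nu] being positive in that case. *)
Lemma phi_exp_quasi_decreasing : exists2 K, 1 <= K &
  forall l l', 1 <= l -> l <= l' -> phi_exp l' <= K * phi_exp l.
Proof.
have [tau0|tau0] := leP 0 tau.
  exists 1 => // l l' l1 ll'; rewrite mul1r /phi_exp.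
  have l0 : 0 < l := lt_le_trans ltr01 l1.
  have l'0 : 0 < l' := lt_le_trans l0 ll'.
  rewrite !powR_expR_ln// -!expRD ler_expR.
  have : nu * l <= nu * l' by rewrite ler_wpM2l.
  have : tau * ln l <= tau * ln l' by rewrite ler_wpM2l// ler_ln ?posrE.
  lra.
have nup : 0 < nu by case: hnutau => [//|[_ /lt_trans/(_ tau0)]]; rewrite ltxx.
have [K K0 HK] := powR_expRN_bounded (- tau) nup.
exists (Num.max 1 (expR nu * K)); first by rewrite le_max lexx.
move=> l l' l1 ll'.
have l0 : 0 < l := lt_le_trans ltr01 l1.
have l'0 : 0 < l' := lt_le_trans l0 ll'.
apply: (@le_trans _ _ ((expR nu * K) * phi_exp l)); last first.
  by rewrite ler_wpM2r ?phi_exp_ge0// le_max lexx orbT.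
have u1 : 1 <= 1 + (l' - l) by lra.
have u0 := lt_le_trans ltr01 u1.
apply: (@le_trans _ _ (expR nu * ((1 + (l' - l)) `^ (- tau) *
    expR (- (nu * (1 + (l' - l))))) * phi_exp l)); last first.
  by rewrite ler_wpM2r ?phi_exp_ge0// ler_wpM2l ?expR_ge0// HK.
rewrite /phi_exp !powR_expR_ln// -!expRD ler_expR.
have : ln l' <= ln (1 + (l' - l)) + ln l.
  by rewrite -lnM ?posrE// ler_ln ?posrE ?mulr_gt0//; nra.
have tN : 0 < - tau by rewrite oppr_gt0.
move=> /(ler_wpM2l (ltW tN)); lra.
Qed.

(** Needed at the last candidate, where the variance is at least 1: there the bias bound must lie
    below a fixed constant. *)
Lemma phi_exp_cvg0 eps : 0 < eps -> exists2 l0, 1 <= l0 &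
  forall l, l0 <= l -> phi_exp l <= eps.
Proof.
move=> eps0; case: hnutau => [nup|[nuE tau0]].
  have nu2 : 0 < nu / 2 by rewrite divr_gt0.
  have [K K0 HK] := powR_expRN_bounded (- tau) nu2.
  exists (Num.max 1 (2 * K / (nu * eps))); first by rewrite le_max lexx.
  move=> l; rewrite ge_max => /andP[l1 lK].
  have l0 : 0 < l := lt_le_trans ltr01 l1.
  have -> : phi_exp l = expR (- (nu / 2 * l)) * (l `^ (- tau) * expR (- (nu / 2 * l))).
    rewrite /phi_exp mulrCA -expRD mulrC; congr (_ * expR _).
    by field.
  apply: (@le_trans _ _ (expR (- (nu / 2 * l)) * K)).
    by rewrite ler_wpM2l ?expR_ge0// HK.
  rewrite expRN ler_pdivrMl ?expR_gt0//.
  have := expR_ge1Dx (nu / 2 * l).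
  have : K <= eps * (nu / 2 * l).
    by move: lK; rewrite ler_pdivrMr ?mulr_gt0//; lra.
  have : 0 < eps by []. nra.
exists (Num.max 1 (eps `^ (- tau^-1))); first by rewrite le_max lexx.
move=> l; rewrite ge_max => /andP[l1 lK].
have l0 : 0 < l := lt_le_trans ltr01 l1.
rewrite /phi_exp nuE mul0r oppr0 expR0 mul1r.
move: lK; rewrite !powR_expR_ln// -[l in leRHS]lnK ?posrE// ler_expR => lK.
rewrite -[leRHS]lnK ?posrE// ler_expR.
move: lK => /(ler_wpM2l (ltW tau0)).
have -> : tau * (- tau^-1 * ln eps) = - ln eps by field; rewrite gt_eqF.
lra.
Qed.

Lemma powR_comparable (A B r : R) : 0 < A -> 0 < B ->
  exists2 C, 0 < C & forall x y, 0 < x -> A * x <= y -> y <= B * x ->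
    y `^ r <= C * x `^ r.
Proof.
move=> A0 B0; exists (A `^ r + B `^ r); first by rewrite addr_gt0 ?powR_gt0.
move=> x y x0 Ay yB.
have y0 : 0 < y by apply: lt_le_trans Ay; rewrite mulr_gt0.
rewrite mulrDl -!powRM ?(ltW A0) ?(ltW B0) ?(ltW x0)//.
have [r0|r0] := leP 0 r.
  rewrite (@le_trans _ _ ((B * x) `^ r))// ?lerDr ?powR_ge0//.
  by rewrite ge0_ler_powR ?nnegrE ?(ltW y0)// mulr_ge0 ?ltW.
rewrite (@le_trans _ _ ((A * x) `^ r))// ?lerDl ?powR_ge0//.
rewrite !powR_expR_ln ?mulr_gt0// ler_expR ler_wnM2l ?(ltW r0)//.
by rewrite ler_ln ?posrE ?mulr_gt0.
Qed.

Variable w : R.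
Hypothesis w0 : 0 < w.

Let N := 2 * nu + 1.
Let N0 : 0 < N. Proof. by rewrite /N ltr_wpDl// mulr_ge0. Qed.

(** The claimed bound, up to its constant, for [Lam = - ln (sigma ^+ 2)] and [w = 1 / vartheta]. *)
Definition rate (Lam : R) : R :=
  expR (- (2 * nu / (2 * nu + 1) * Lam)) *
  Lam `^ ((2 * nu * w - 2 * tau) / (2 * nu + 1)).

(** The left side is the order of the contribution of late stops. Its exponent exceeds that of the
    rate by [Lam / (2 * nu + 1)], which outweighs any power of [Lam]. *)
Lemma noise_le_rate : exists2 C, 0 < C & forall Lam, 1 <= Lam ->
  expR (- Lam) * Lam ^+ 2 <= C * rate Lam.
Proof.
have Ni0 : 0 < N^-1 by rewrite invr_gt0.
pose p := (2 * nu * w - 2 * tau) / N.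
have [C C0 HC] := powR_expRN_bounded (2 - p) Ni0.
exists C => // Lam Lam1; have Lam0 : 0 < Lam := lt_le_trans ltr01 Lam1.
have -> : expR (- Lam) * Lam ^+ 2 = (Lam `^ (2 - p) * expR (- (N^-1 * Lam))) * rate Lam.
  rewrite -powR_mulrn ?(ltW Lam0)// /rate -/N -/p !powR_expR_ln// -!expRD.
  congr expR; rewrite /N; field.
  by rewrite gt_eqF.
by rewrite ler_wpM2r ?HC// /rate mulr_ge0 ?expR_ge0 ?powR_ge0.
Qed.

(** The variance bound is increasing in [l], the squared bias bound is
    decreasing up to a constant, and both are of the order of the rate at
    [l = (Lam - (w + 2 * tau) * ln Lam) / (2 * nu + 1)]. *)
Lemma balanced_le_rate (K1 K2 : R) : 0 < K1 -> 0 < K2 ->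
  exists2 C, 0 < C & exists2 Lam0, 1 <= Lam0 & forall Lam l v, Lam0 <= Lam ->
    1 <= l -> v <= expR (- Lam) * (K1 * l `^ w * expR l) ->
    v <= K2 * phi_exp l ^+ 2 -> v <= C * rate Lam.
Proof.
move=> K10 K20; pose p := w + 2 * tau.
have [K K1' HK] := phi_exp_quasi_decreasing.
have K0 := lt_le_trans ltr01 K1'.
have A0 : 0 < (2 * N)^-1 by rewrite invr_gt0 mulr_gt0.
have B0 : 0 < 3 / (2 * N) by rewrite divr_gt0 ?mulr_gt0.
have [C1 C10 HC1] := powR_comparable w A0 B0.
have [C2 C20 HC2] := powR_comparable (- (2 * tau)) A0 B0.
exists (K1 * C1 + K2 * K ^+ 2 * C2); first by rewrite addr_gt0 ?mulr_gt0 ?exprn_gt0.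
(* This slope yields [|p * ln Lam| <= Lam / 2] for large [Lam]. Hence the balancing point [lb] lies
   between [Lam / (2 * N)] and [3 * Lam / (2 * N)], and its powers are comparable to those of
   [Lam]. *)
pose t := (4 * (`|p| + 1))^-1.
have p1 : 0 < `|p| + 1 by rewrite ltr_wpDl.
have t0 : 0 < t by rewrite invr_gt0 mulr_gt0.
exists (Num.max 1 (Num.max (2 * N) (4 * (`|p| * `|ln t|)))).
  by rewrite le_max lexx.
move=> Lam l v; rewrite !ge_max => /and3P[Lam1 LamN Lamt] l1 hv1 hv2.
have Lam0 : 0 < Lam := lt_le_trans ltr01 Lam1.
have l0 : 0 < l := lt_le_trans ltr01 l1.
have pln : `|p * ln Lam| <= Lam / 2.
  have lnL0 : 0 <= ln Lam by rewrite ln_ge0.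
  rewrite normrM (ger0_norm lnL0).
  have := ler_wpM2l (normr_ge0 p) (ln_le_mul_sub Lam0 t0).
  have : `|p| * - ln t <= `|p| * `|ln t| by rewrite ler_wpM2l// -normrN ler_norm.
  have : `|p| * (Lam * t) <= Lam / 4.
    have -> : `|p| * (Lam * t) = `|p| / (`|p| + 1) * (Lam / 4).
      by rewrite /t; field; rewrite gt_eqF.
    rewrite ler_piMl ?divr_ge0 ?(ltW Lam0)//.
    by rewrite ler_pdivrMr// mul1r lerDl.
  have := normr_ge0 p; lra.
pose lb := (Lam - p * ln Lam) / N.
have := pln; rewrite ler_norml => /andP[pl1 pl2].
have lbA : (2 * N)^-1 * Lam <= lb.
  rewrite ler_pdivlMr//.
  have -> : (2 * N)^-1 * Lam * N = Lam / 2 by field; rewrite gt_eqF.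
  lra.
have lbB : lb <= 3 / (2 * N) * Lam.
  rewrite ler_pdivrMr//.
  have -> : 3 / (2 * N) * Lam * N = 3 * Lam / 2 by field; rewrite gt_eqF.
  lra.
have lb1 : 1 <= lb.
  by rewrite (le_trans _ lbA)// ler_pdivlMl ?mulr_gt0// mulr1.
have lb0 : 0 < lb := lt_le_trans ltr01 lb1.
have rate0 : 0 <= rate Lam by rewrite /rate mulr_ge0 ?expR_ge0 ?powR_ge0.
have [llb|/ltW lbl] := leP l lb.
  apply: (@le_trans _ _ (K1 * C1 * rate Lam)); last first.
    by rewrite ler_wpM2r// lerDl !mulr_ge0 ?sqr_ge0 ?ltW.
  apply: (le_trans hv1).
  apply: (@le_trans _ _ (expR (- Lam) * (K1 * (C1 * Lam `^ w) * expR lb))).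
    rewrite ler_wpM2l ?expR_ge0// ler_pM ?mulr_ge0 ?expR_ge0 ?powR_ge0 ?ler_expR ?(ltW K10)//.
    rewrite ler_pM2l// (le_trans _ (HC1 _ _ Lam0 lbA lbB))//.
    by rewrite ge0_ler_powR ?nnegrE ?(ltW l0) ?(ltW lb0) ?(ltW w0).
  have -> : expR (- Lam) * (K1 * (C1 * Lam `^ w) * expR lb) =
      K1 * C1 * (expR (- Lam) * Lam `^ w * expR lb) by ring.
  rewrite ler_pM2l ?mulr_gt0// /rate !powR_expR_ln// -!expRD ler_expR.
  rewrite le_eqVlt; apply/orP; left; apply/eqP.
  by rewrite /lb /p /N; field; rewrite gt_eqF.
apply: (@le_trans _ _ (K2 * K ^+ 2 * C2 * rate Lam)); last first.
  by rewrite ler_wpM2r// lerDr !mulr_ge0 ?sqr_ge0 ?ltW.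
apply: (le_trans hv2).
rewrite -[_ * C2 * _]mulrA -[K2 * _ * _]mulrA ler_pM2l//.
apply: (@le_trans _ _ ((K * phi_exp lb) ^+ 2)).
  by rewrite ler_pXn2r ?nnegrE ?phi_exp_ge0 ?(mulr_ge0 (ltW K0)) ?phi_exp_ge0// HK.
rewrite exprMn ler_pM2l ?exprn_gt0// /phi_exp exprMn.
have -> : (lb `^ (- tau)) ^+ 2 = lb `^ (- (2 * tau)).
  by rewrite -powR_mulrn ?powR_ge0// -powRrM; congr (_ `^ _); ring.
apply: (@le_trans _ _ (expR (- (nu * lb)) ^+ 2 * (C2 * Lam `^ (- (2 * tau))))).
  by rewrite ler_wpM2l ?sqr_ge0// HC2.
rewrite mulrCA ler_pM2l// /rate !powR_expR_ln// expr2 -!expRD ler_expR.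
rewrite le_eqVlt; apply/orP; left; apply/eqP.
by rewrite /lb /p /N; field; rewrite gt_eqF.
Qed.

End Rate.

(** * Consequences of the exponential moment *)

Section AeLeIntegral.
Import HBNNSimple.

(** The integral of a nonnegative function is a supremum over simple functions below it, and only
    these are compared with [g]. The loss at the selected index can thus be bounded without a study
    of its measurability. *)
Lemma ae_le_integral_nonmeasurable (d : measure_display) (T : measurableType d)
    (R : realType) (mu : {measure set T -> \bar R}) (f g : T -> \bar R) :
  (forall x, 0 <= f x)%E -> (forall x, 0 <= g x)%E -> measurable_fun setT g ->
  {ae mu, forall x, (f x <= g x)%E} ->
  (\int[mu]_x f x <= \int[mu]_x g x)%E.
Proof.
move=> f0 g0 mg fg; rewrite [leLHS]ge0_integralTE//.
apply: ge_ereal_sup => _ [h /= hf <-]; rewrite -integralT_nnsfun.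
apply: ae_ge0_le_integral => //.
- by move=> x _; rewrite lee_fin fun_ge0.
- exact/measurable_EFinP.
- by apply: filterS fg => x fgx _; exact: le_trans (hf x) fgx.
Qed.

End AeLeIntegral.

Section ExpMoment.
Variables (R : realType) (d : measure_display) (Omega : measurableType d).
Variables (P : probability Omega R) (D : Omega -> R).
Hypotheses (mD : measurable_fun setT D) (D0 : forall w, 0 <= D w).

Lemma expR_half_le2 : expR (1 / 2) <= 2 :> R.
Proof.
have := expR_ge1Dx (- (1 / 2) : R); rewrite expRN.
rewrite -[leRHS]mul1r ler_pdivlMr ?expR_gt0//.
lra.
Qed.

Section moments.
Variables (V : R) (V0 : 0 < V).
Hypothesis expD : (\int[P]_w (expR (D w / (4 * V)))%:E <= (expR (V / (2 * V)))%:E)%E.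

Let expD2 : (\int[P]_w (expR (D w / (4 * V)))%:E <= 2%:E)%E.
Proof.
apply: (le_trans expD); rewrite lee_fin (le_trans _ expR_half_le2)// ler_expR.
by rewrite le_eqVlt; apply/orP; left; apply/eqP; field; rewrite gt_eqF.
Qed.

Let V40 : 0 < 4 * V. Proof. by rewrite mulr_gt0. Qed.

Let mexpD c : measurable_fun setT (fun w => (c%:E * (expR (D w / (4 * V)))%:E)%E).
Proof.
apply: measurable_funeM; apply/measurable_EFinP; apply: measurableT_comp => //.
exact: measurable_funM.
Qed.

(** [y <= exp y] at [y = D / (4 * V)], whose exponential has expectation at most [exp (1 / 2) <= 2].
    The second moment uses the square of the same inequality at [D / (8 * V)]. *)
Lemma first_moment_le : (\int[P]_w (D w)%:E <= (8 * V)%:E)%E.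
Proof.
apply: (@le_trans _ _ (\int[P]_w ((4 * V)%:E * (expR (D w / (4 * V)))%:E)))%E.
  apply: ge0_le_integral => //.
  - by move=> w _; rewrite lee_fin D0.
  - exact/measurable_EFinP.
  - move=> w _; rewrite -EFinM lee_fin -ler_pdivrMl// mulrC.
    by rewrite (le_trans _ (expR_ge1Dx _))// lerDr.
rewrite ge0_integralZl//; last 2 first.
- apply/measurable_EFinP; apply: measurableT_comp => //.
  exact: measurable_funM.
- by rewrite lee_fin ltW.
rewrite (le_trans (lee_wpmul2l _ expD2)) ?lee_fin ?(ltW V40)//.
lra.
Qed.

Lemma second_moment_le : (\int[P]_w (D w ^+ 2)%:E <= (128 * V ^+ 2)%:E)%E.
Proof.
apply: (@le_trans _ _ (\int[P]_w ((64 * V ^+ 2)%:E * (expR (D w / (4 * V)))%:E)))%E.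
  apply: ge0_le_integral => //.
  - by move=> w _; rewrite lee_fin sqr_ge0.
  - exact/measurable_EFinP/measurable_funX.
  - move=> w _; rewrite -EFinM lee_fin.
    have -> : D w / (4 * V) = D w / (8 * V) + D w / (8 * V).
      by field; rewrite gt_eqF.
    rewrite expRD -expr2.
    have -> : 64 * V ^+ 2 * expR (D w / (8 * V)) ^+ 2 =
        (8 * V * expR (D w / (8 * V))) ^+ 2.
      by ring.
    have V80 : 0 < 8 * V by rewrite mulr_gt0.
    rewrite ler_pXn2r ?nnegrE ?mulr_ge0 ?expR_ge0 ?(ltW V0)//.
    rewrite -ler_pdivrMl// mulrC.
    by rewrite (le_trans _ (expR_ge1Dx _))// lerDr.
have V2 : 0 <= 64 * V ^+ 2 by rewrite mulr_ge0 ?sqr_ge0.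
rewrite ge0_integralZl//; last first.
  apply/measurable_EFinP; apply: measurableT_comp => //.
  exact: measurable_funM.
rewrite (le_trans (lee_wpmul2l _ expD2)) ?lee_fin//.
lra.
Qed.

End moments.

(** Markov's inequality for [exp (D / (4 * A))] at level [z]. Since the tail at [z] is exactly
    [exp (- x)], the tail bound becomes an upper bound on [z]. *)
Lemma tail_quantile_sqr_le (n : Omega -> R) (A V z x : R) :
  0 < A -> (forall w, 0 <= n w) -> (forall w, D w = n w ^+ 2) ->
  measurable_fun setT n ->
  (\int[P]_w (expR (D w / (4 * A)))%:E <= (expR (V / (2 * A)))%:E)%E ->
  P [set w | z < n w] = (expR (- x))%:E -> 0 <= z ->
  z ^+ 2 <= 2 * V + 4 * A * x.
Proof.
move=> A0 n0 Dn mn expD Pz z0.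
have A40 : 0 < 4 * A by rewrite mulr_gt0.
pose S := [set w | z < n w].
have mS : measurable S.
  rewrite (_ : S = setT `&` n @^-1` `]z, +oo[%classic).
    exact: mn.
  by rewrite setTI; apply/seteqP; split => w /=; rewrite in_itv/= andbT.
have : ((expR (z ^+ 2 / (4 * A)))%:E * P S <= (expR (V / (2 * A)))%:E)%E.
  apply: le_trans expD.
  rewrite -integral_cst//.
  apply: (@le_trans _ _ (\int[P]_(w in S) (expR (D w / (4 * A)))%:E))%E.
    apply: ge0_le_integral => //.
    - by move=> w _; rewrite lee_fin expR_ge0.
    - apply/measurable_EFinP; apply: measurable_funTS; apply: measurableT_comp => //.
      exact: measurable_funM.
    - move=> w /= zn; rewrite lee_fin ler_expR ler_pM2r ?invr_gt0// Dn.
      by rewrite ler_pXn2r ?nnegrE// ltW.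
  apply: ge0_subset_integral => //.
  apply/measurable_EFinP; apply: measurableT_comp => //.
  exact: measurable_funM.
rewrite Pz -EFinM lee_fin -expRD ler_expR.
rewrite lerBlDr ler_pdivrMr//.
have -> : (V / (2 * A) + x) * (4 * A) = 2 * V + 4 * A * x.
  by field; rewrite gt_eqF.
by [].
Qed.

End ExpMoment.

Lemma nneg_series_lim (R : realType) (u : nat -> R) (B : R) :
  (forall k, 0 <= u k) -> (forall N, \sum_(0 <= k < N) u k <= B) ->
  (forall N, \sum_(0 <= k < N) u k <= limn (series u)) /\ limn (series u) <= B.
Proof.
move=> u0 uB.
have nd : {homo series u : n m / (n <= m)%N >-> n <= m}.
  exact: nondecreasing_series.
have cu : cvgn (series u).
  by apply: nondecreasing_is_cvgn => //; exists B => _ [N _ <-]; exact: uB.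
split=> [N|]; first exact: (nondecreasing_cvgn_le nd cu N).
by apply: limr_le => //; exact: nearW.
Qed.

(** The counted set has to be shown finite, by [lam k --> 0]: [fine] would send an infinite count to
    0. *)
Lemma Sigma_ge (R : realType) (lam : nat -> R) (x : R) n : 0 < x ->
  cvgn (series lam) -> (forall k, (k < n)%N -> x <= lam k) ->
  n%:R <= fine (Sigma lam x).
Proof.
move=> x0 /cvg_series_cvg_0/cvgrPdist_lt/(_ _ x0)[N _ lamN] xlam.
have fin : finite_set [set k | x <= lam k].
  apply: (@sub_finite_set _ _ `I_N) => // k /= xk.
  rewrite ltnNge; apply/negP => /lamN /=; rewrite sub0r normrN.
  by rewrite ltNge (le_trans xk)// ler_norm.
rewrite /Sigma /counting asboolT//= ler_nat.
by apply: leq_card_fset_set => //; apply: subset_card_le => k /=; exact: xlam.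
Qed.

Lemma limf_einf_right_gt0 (R : realType) (f : R -> R) :
  (0 < limf_einf (fun a => (f a)%:E) (0 : R)^'+)%E ->
  exists2 c, 0 < c & exists2 del, 0 < del & forall a, 0 < a < del -> c <= f a.
Proof.
rewrite limf_einfE => /ereal_sup_gt[_ [V V0 <-]] infV.
have [c c0 cinf] : exists2 c, 0 < c & (c%:E <= ereal_inf [set (f x)%:E | x in V])%E.
  case: (ereal_inf _) infV => [r|_|//]; last by exists 1; rewrite ?leey.
  by rewrite lte_fin => r0; exists r.
exists c => //; case: V0 => del /= del0 delV; exists del => // a /andP[a0 adel].
rewrite -lee_fin (le_trans cinf)//; apply: ereal_inf_lbound; exists a => //.
by apply: delV => //=; rewrite sub0r normrN gtr0_norm.
Qed.

Lemma nat_minP (Q : set nat) : Q !=set0 ->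
  Q (nat_min Q) /\ forall j, Q j -> (nat_min Q <= j)%N.
Proof.
move=> [n Qn]; rewrite /nat_min.
have exQ : exists n, `[< Q n >] by exists n; apply/asboolP.
case: (ex_minnP exQ) => m /asboolP Qm mmin.
by case: xgetP => [k _ //|/(_ m)[]]; split => // j Qj; apply: mmin; apply/asboolP.
Qed.

(** * Variances, biases and the stopping rule *)

Lemma expr_gt1_unbounded (R : realType) (t x : R) : 1 < t -> exists N, x <= t ^+ N.
Proof.
move=> t1; have h0 : 0 < t - 1 by rewrite subr_gt0.
have Bernoulli n : n%:R * (t - 1) <= t ^+ n.
  suff : 1 + n%:R * (t - 1) <= t ^+ n by apply: le_trans; rewrite lerDr.
  elim: n => [|n IH]; first by rewrite mul0r addr0.
  rewrite exprS -natr1.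
  have := ler_wpM2l (ltW (lt_trans ltr01 t1)) IH; apply: le_trans.
  have : 0 <= n%:R * (t - 1) ^+ 2 by rewrite mulr_ge0 ?sqr_ge0.
  nra.
exists (Num.truncn (x / (t - 1))).+1; apply: le_trans (Bernoulli _).
by rewrite -ler_pdivrMr// ltW// truncnS_gt.
Qed.

Section Candidates.
Variables (R : realType) (lam : nat -> R) (q : R -> R -> R) (al : nat -> R).
Variables (Cq theta1 theta2 : R).
Hypotheses (lam0 : forall k, 0 < lam k) (clam : cvgn (series lam)).
Hypotheses (Cq0 : 0 < Cq) (al0 : forall m, 0 < al m).
Hypothesis q0 : forall m k, 0 <= q (al m) (lam k).
Hypothesis qC : forall m k, al m * q (al m) (lam k) <= Cq.
Hypothesis q1 : forall m k, lam k * q (al m) (lam k) <= 1.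
Hypothesis qmono : forall m m' k, (m <= m')%N ->
  q (al m) (lam k) <= q (al m') (lam k).
Hypothesis theta : 1 < theta1.
Hypothesis Vratio : forall m,
  theta1 <= Vfun lam q (al m.+1) / Vfun lam q (al m) <= theta2.

Local Notation V m := (Vfun lam q (al m)).
Local Notation Vd m1 m2 := (Vdiff lam q (al m1) (al m2)).

Lemma filter_le m k : q (al m) (lam k) <= Cq / al m.
Proof. by rewrite ler_pdivlMr// mulrC. Qed.

Lemma filter_norm_le m k : `|q (al m) (lam k)| <= Cq / al m.
Proof. by rewrite ger0_norm// filter_le. Qed.

Lemma lam_sum_le N : \sum_(0 <= k < N) lam k <= limn (series lam).
Proof.
apply: (nondecreasing_cvgn_le _ clam); apply: nondecreasing_series => k _ _.
exact: ltW.
Qed.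

Lemma lam_filter_sqr_le m k : lam k * q (al m) (lam k) ^+ 2 <= Cq / al m.
Proof.
rewrite expr2 mulrA (le_trans _ (filter_le m k))//.
by rewrite -[leRHS]mul1r ler_wpM2r.
Qed.

Let Vpartial m N : \sum_(0 <= k < N) lam k * q (al m) (lam k) ^+ 2
  <= (Cq / al m) ^+ 2 * limn (series lam).
Proof.
apply: (@le_trans _ _ (\sum_(0 <= k < N) (Cq / al m) ^+ 2 * lam k)).
  apply: ler_sum => k _; rewrite mulrC ler_wpM2r ?(ltW (lam0 k))//.
  by rewrite ler_pXn2r ?nnegrE ?filter_le// divr_ge0 ?ltW.
by rewrite -mulr_sumr ler_wpM2l ?sqr_ge0// lam_sum_le.
Qed.

Let lamq0 m k : 0 <= lam k * q (al m) (lam k) ^+ 2.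
Proof. by rewrite mulr_ge0 ?sqr_ge0 ?ltW. Qed.

Lemma Vfun_partial m N : \sum_(0 <= k < N) lam k * q (al m) (lam k) ^+ 2 <= V m.
Proof. by have [h _] := nneg_series_lim (lamq0 m) (Vpartial m); exact: h. Qed.

Lemma Vfun_le m B :
  (forall N, \sum_(0 <= k < N) lam k * q (al m) (lam k) ^+ 2 <= B) -> V m <= B.
Proof. by move=> /(nneg_series_lim (lamq0 m))[]. Qed.

(** Crude, but polynomial in [1 / al m]: this suffices to bound [ln (V m)] by a multiple of
    [- ln (al m)], and to force [al m] to be small where [V m] is large. *)
Lemma Vfun_al m : V m <= (Cq / al m) ^+ 2 * limn (series lam).
Proof. exact/Vfun_le/Vpartial. Qed.

(** A quotient by 0 is 0, so the lower ratio bound [theta1 > 1] excludes [V m = 0]. *)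
Lemma Vfun_gt0 m : 0 < V m.
Proof.
have V0 : 0 <= V m.
  by rewrite (le_trans _ (Vfun_partial m 0%N))// big_geq.
rewrite lt_neqAle V0 andbT eq_sym; apply/eqP => Vm.
have := Vratio m; rewrite Vm invr0 mulr0 => /andP[t0 _].
by have := lt_le_trans theta t0; rewrite ltr10.
Qed.

Lemma Vfun_S m : theta1 * V m <= V m.+1 <= theta2 * V m.
Proof.
by have := Vratio m; rewrite ler_pdivlMr ?Vfun_gt0// ler_pdivrMr ?Vfun_gt0.
Qed.

Lemma Vfun_exp m : theta1 ^+ m * V 0%N <= V m.
Proof.
elim: m => [|m IH]; first by rewrite expr0 mul1r.
have /andP[+ _] := Vfun_S m; apply: le_trans.
by rewrite exprS -mulrA ler_wpM2l// (le_trans ler01)// ltW.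
Qed.

Lemma Vfun_mono m m' : (m <= m')%N -> V m <= V m'.
Proof.
elim: m' => [|m' IH]; first by rewrite leqn0 => /eqP ->.
rewrite leq_eqVlt => /predU1P[->//|/IH h]; apply: le_trans h _.
have /andP[+ _] := Vfun_S m'; apply: le_trans.
by rewrite ler_peMl ?(ltW (Vfun_gt0 m'))// ltW.
Qed.

Lemma Vfun_theta1 m m' : (m < m')%N -> theta1 * V m <= V m'.
Proof.
move=> mm'; have /andP[h _] := Vfun_S m.
by apply: le_trans h _; exact: Vfun_mono.
Qed.

Section Differences.
Variables (m1 m2 : nat) (m12 : (m1 <= m2)%N).

Let dq k := q (al m1) (lam k) - q (al m2) (lam k).

Let dq2_le k : lam k * dq k ^+ 2 <= lam k * q (al m2) (lam k) ^+ 2.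
Proof.
rewrite ler_pM2l// -sqrrN opprB.
have := qmono k m12; have := q0 m1 k => h0 h1.
by rewrite ler_pXn2r ?nnegrE ?subr_ge0// gerBl.
Qed.

Let dq20 k : 0 <= lam k * dq k ^+ 2.
Proof. by rewrite mulr_ge0 ?sqr_ge0 ?ltW. Qed.

Let dq_partial N : \sum_(0 <= k < N) lam k * dq k ^+ 2 <= V m2.
Proof. by apply: le_trans (Vfun_partial m2 N); exact: ler_sum. Qed.

Lemma Vdiff_term_le k : lam k * dq k ^+ 2 <= Cq / al m2.
Proof. by rewrite (le_trans (dq2_le k))// lam_filter_sqr_le. Qed.

Lemma Vdiff_partial N : \sum_(0 <= k < N) lam k * dq k ^+ 2 <= Vd m1 m2.
Proof. by have [h _] := nneg_series_lim dq20 dq_partial; exact: h. Qed.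

Lemma Vdiff_le : Vd m1 m2 <= V m2.
Proof. by have [] := nneg_series_lim dq20 dq_partial. Qed.

(** For [0 <= a <= b] one has [b^2 - a^2 <= 2 * b * (b - a) <= eps * b^2 + (a - b)^2 / eps]. After
    summation, [V m1 <= V m2 / theta1 = (1 - 2 * eps) * V m2] leaves [eps * V m2] on the left. *)
Lemma Vdiff_ge : (m1 < m2)%N ->
  ((1 - theta1^-1) / 2) ^+ 2 * V m2 <= Vd m1 m2.
Proof.
move=> lt12; set eps := (1 - theta1^-1) / 2.
have t0 : 0 < theta1 := lt_trans ltr01 theta.
have eps0 : 0 < eps.
  by rewrite divr_gt0// subr_gt0 invf_lt1.
have : V m2 <= V m1 + eps * V m2 + eps^-1 * Vd m1 m2.
  apply: Vfun_le => N.
  apply: (@le_trans _ _ (\sum_(0 <= k < N) (lam k * q (al m1) (lam k) ^+ 2 +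
      eps * (lam k * q (al m2) (lam k) ^+ 2) + eps^-1 * (lam k * dq k ^+ 2)))).
    apply: ler_sum => k _; rewrite /dq.
    set a := q (al m1) _; set b := q (al m2) _.
    have ab : a <= b by exact: qmono.
    have a0 : 0 <= a by exact: q0.
    have -> : lam k * a ^+ 2 + eps * (lam k * b ^+ 2) + eps^-1 * (lam k * (a - b) ^+ 2) =
      lam k * (a ^+ 2 + eps * b ^+ 2 + eps^-1 * (a - b) ^+ 2) by ring.
    rewrite ler_pM2l//.
    have : 0 <= eps^-1 * (eps * b - (b - a)) ^+ 2.
      by rewrite mulr_ge0 ?sqr_ge0// invr_ge0 ltW.
    have -> : eps^-1 * (eps * b - (b - a)) ^+ 2 =
       eps * b ^+ 2 - 2 * b * (b - a) + eps^-1 * (a - b) ^+ 2.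
      by field; rewrite gt_eqF.
    nra.
  rewrite !big_split/= -!mulr_sumr; apply: lerD; last first.
    by rewrite ler_wpM2l ?invr_ge0 ?(ltW eps0)// Vdiff_partial.
  by apply: lerD; [exact: Vfun_partial|rewrite ler_wpM2l ?(ltW eps0)// Vfun_partial].
have : V m1 <= theta1^-1 * V m2 by rewrite ler_pdivlMl// Vfun_theta1.
have -> : theta1^-1 = 1 - 2 * eps by rewrite /eps; field; rewrite gt_eqF.
move=> h1 h2.
have : eps * V m2 <= eps^-1 * Vd m1 m2 by lra.
by rewrite ler_pdivlMl// mulrA -expr2.
Qed.

End Differences.

Section Estimator.
Variables (X : completeNormedModType R) (ip : {dot X for idfun}).
Hypothesis hip : induces_norm ip.
Variables (e : nat -> X) (he : orthonormal_basis ip e).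
Variables (Af : X -> X) (hAf : forall x k, ip (Af x) (e k) = lam k * ip x (e k)).

Local Notation fh m h := (fhat ip e lam q (al m) h).

Definition bias m f := f - fh m (Af f).

Lemma fhat_coef m h k : ip (fh m h) (e k) = q (al m) (lam k) * ip h (e k).
Proof. exact: (fcalc_coef hip he (filter_norm_le m)). Qed.

Lemma bias_coef m f k :
  ip (bias m f) (e k) = (1 - lam k * q (al m) (lam k)) * ip f (e k).
Proof. by rewrite ipBl fhat_coef hAf; ring. Qed.

Lemma fhat_error m f s h :
  fh m (Af f + s *: h) - f = s *: fh m h - bias m f.
Proof.
apply: (coef_inj he) => k.
rewrite !(ipBl, ipDl, ipZl, fhat_coef, bias_coef) hAf; ring.
Qed.

Lemma bias_mono m m' f : (m <= m')%N -> `|bias m' f| <= `|bias m f|.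
Proof.
move=> mm'; rewrite -[leRHS]mul1r; apply: (norm_le_coef hip he) => // k.
rewrite mul1r !bias_coef !normrM ler_wpM2r//.
by rewrite !ger0_norm ?subr_ge0// lerB// ler_pM2l// qmono.
Qed.

(** By the ordering of the filter, [0 <= 1 - lam k * q (al m') (lam k) <= 1 - lam k * q (al m) (lam
    k)], so subtracting the later bias shrinks every coefficient. *)
Lemma bias_diff_le m m' f : (m <= m')%N -> `|bias m f - bias m' f| <= `|bias m f|.
Proof.
move=> mm'; rewrite -[leRHS]mul1r; apply: (norm_le_coef hip he) => // k.
rewrite mul1r ipBl !bias_coef -mulrBl !normrM ler_wpM2r//.
rewrite opprB addrA addrC addrA addKr.
have := qmono k mm'; rewrite -(ler_pM2l (lam0 k)) => h.
rewrite addrC ger0_norm ?subr_ge0// ger0_norm ?subr_ge0// lerD2r.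
exact: q1.
Qed.

Lemma fhat_diff m m' h : fh m h - fh m' h =
  fcalc ip e lam (fun x => q (al m) x - q (al m') x) h.
Proof.
apply: (coef_inj he) => k.
rewrite (fcalc_coef hip he (M := Cq / al m + Cq / al m')).
  by rewrite ipBl !fhat_coef mulrBl.
by move=> j; rewrite (le_trans (ler_normB _ _))// lerD ?filter_norm_le.
Qed.

Lemma fhat_error_diff m m' f s h :
  fh m (Af f + s *: h) - fh m' (Af f + s *: h) =
  s *: (fh m h - fh m' h) - (bias m f - bias m' f).
Proof.
apply: (coef_inj he) => k.
rewrite !(ipBl, ipDl, ipZl, fhat_coef, bias_coef) hAf; ring.
Qed.

Lemma sqr_normD_le (u v : X) : `|u + v| ^+ 2 <= 2 * `|u| ^+ 2 + 2 * `|v| ^+ 2.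
Proof.
apply: (@le_trans _ _ ((`|u| + `|v|) ^+ 2)).
  by rewrite ler_pXn2r ?nnegrE ?addr_ge0// ler_normD.
have := sqr_ge0 (`|u| - `|v|); nra.
Qed.

Lemma fhat_risk_le m f s h :
  `|fh m (Af f + s *: h) - f| ^+ 2 <=
    2 * `|bias m f| ^+ 2 + 2 * (s ^+ 2 * `|fh m h| ^+ 2).
Proof.
rewrite fhat_error (le_trans (sqr_normD_le _ _))// normrN addrC lerD2l.
by rewrite ler_pM2l// normrZ exprMn real_normK ?num_real.
Qed.

Section SOLIT.
Variables (z : nat -> nat -> R -> R) (beta gamma sigma : R).
Hypotheses (beta0 : 0 < beta) (sigma0 : 0 < sigma).

Local Notation mM := (mmax lam q al sigma).
Local Notation eps := ((1 - theta1^-1) / 2).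

Lemma mmax_spec : [/\ (1 <= mM)%N, 1 <= sigma ^+ 2 * V mM &
  forall j, (1 <= j < mM)%N -> sigma ^+ 2 * V j < 1].
Proof.
have ne : [set m | (1 <= m)%N /\ 1 <= vm lam q al sigma m] !=set0.
  have [N N1] : exists N, (sigma ^+ 2 * V 0%N)^-1 <= theta1 ^+ N.
    exact: expr_gt1_unbounded.
  exists N.+1; split => //=; rewrite /vm.
  have s2 : 0 < sigma ^+ 2 by rewrite exprn_gt0.
  apply: (@le_trans _ _ (sigma ^+ 2 * (theta1 ^+ N * V 0%N))); last first.
    rewrite ler_pM2l// (le_trans (Vfun_exp N))// Vfun_mono//.
  by rewrite mulrCA -ler_pdivrMr ?mulr_gt0 ?Vfun_gt0// mul1r.
have [[h1 h2] h3] := nat_minP ne; split => // j /andP[j1 jM].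
rewrite ltNge; apply/negP => vj; move: jM; rewrite ltnNge => /negP; apply.
exact: h3.
Qed.

(** A pathwise statement, for a fixed noise vector [h]. In the second case [m] is the predecessor of
    the selected index; it was rejected against some [m2], and once the bias is charged to the
    [beta] part of the threshold, the noise alone exceeds the quantile. *)
Lemma solit_dichotomy (M : nat) (etaM : R) f h :
  (M <= mM)%N -> `|bias M f| ^+ 2 <= (beta * eps) ^+ 2 * (sigma ^+ 2 * V M) ->
  (forall m1, (m1 < M)%N -> Defs.eta lam q al z beta gamma sigma m1 M <= etaM) ->
  let hY := Af f + sigma *: h in
  let mh := solit ip e lam q al z beta gamma sigma hY in
  let loss := `|fh mh hY - f| ^+ 2 in
  loss <= 2 * etaM ^+ 2 + 4 * `|bias M f| ^+ 2 + 4 * (sigma ^+ 2 * `|fh M h| ^+ 2)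
  \/ (exists m, [/\ (M <= m)%N, (m.+1 <= mM)%N,
       loss <= 2 * `|bias M f| ^+ 2 + 2 * (sigma ^+ 2 * `|fh m.+1 h| ^+ 2) &
       exists2 m2, (m < m2 <= mM)%N &
         z m m2 (xm lam q al sigma gamma m) < noise_diff ip e lam q al m m2 h]).
Proof.
move=> MmM hB heta hY mh loss.
have ne : [set m1 | (m1 <= mM)%N /\ forall m2, (m1 < m2 <= mM)%N ->
    `|fh m1 hY - fh m2 hY| <= Defs.eta lam q al z beta gamma sigma m1 m2] !=set0.
  exists mM; split => // m2 /andP[h1 h2].
  by move: (leq_trans h1 h2); rewrite ltnn.
have [[mhM mhP] mhmin] := nat_minP ne.
rewrite -[nat_min _]/mh in mhM mhP mhmin.
have lossE : loss = `|fh mh hY - f| ^+ 2 by [].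
clearbody loss mh.
have [mhleM|Mltmh] := leqP mh M.
  left; have := fhat_risk_le M f sigma h; rewrite -/hY => risk.
  have s2D : 0 <= sigma ^+ 2 * `|fh M h| ^+ 2 by rewrite mulr_ge0 ?sqr_ge0.
  have B2 : 0 <= `|bias M f| ^+ 2 by rewrite sqr_ge0.
  have [mhE|mhN] := eqVneq mh M.
    rewrite lossE mhE; have := sqr_ge0 etaM; lra.
  have mhlt : (mh < M)%N by rewrite ltn_neqAle mhN.
  have hd : `|fh mh hY - fh M hY| <= etaM.
    by apply: le_trans (heta _ mhlt); apply: mhP; rewrite mhlt.
  have hd2 : `|fh mh hY - fh M hY| ^+ 2 <= etaM ^+ 2.
    by rewrite ler_pXn2r ?nnegrE// (le_trans _ hd).
  have := sqr_normD_le (fh mh hY - fh M hY) (fh M hY - f).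
  rewrite addrA subrK -lossE; lra.
right; case mhE : mh Mltmh => [//|m] Mm.
rewrite ltnS in Mm.
exists m; split=> //.
- by rewrite -mhE.
- rewrite lossE mhE (le_trans (fhat_risk_le _ _ _ _))// lerD2r ler_pM2l//.
  by rewrite ler_pXn2r ?nnegrE// bias_mono// leqW.
have [h1|/existsNP[m2 /not_implyP[m2P /negP]]] :=
  pselect (forall m2, (m < m2 <= mM)%N -> `|fh m hY - fh m2 hY| <= Defs.eta lam q al z beta gamma sigma m m2).
  have := mhmin m; rewrite mhE ltnn => H; exfalso.
  suff : false by [].
  apply: H; split => //.
  by rewrite ltnW// -mhE.
rewrite -ltNge => hlt; exists m2 => //.
have /andP[mm2 _] := m2P.
move: hlt; rewrite fhat_error_diff /Defs.eta => hlt.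
rewrite -(ltr_pM2l sigma0).
have nd : `|sigma *: (fh m h - fh m2 h) - (bias m f - bias m2 f)| <=
   sigma * noise_diff ip e lam q al m m2 h + `|bias m f|.
  rewrite (le_trans (ler_normB _ _))// normrZ gtr0_norm// lerD2l.
  by rewrite bias_diff_le// ltnW.
(* The bias decreases from [M] to [m] and the variance increases from [M] to [m2]; [Vdiff_ge] then
   replaces [eps ^+ 2 * V m2] by [Vd m m2]. *)
have Bm : `|bias m f| <= beta * Num.sqrt (sigma ^+ 2 * Vd m m2).
  rewrite (le_trans (bias_mono f Mm))//.
  rewrite -(@ler_pXn2r _ 2)// ?nnegrE ?mulr_ge0 ?sqrtr_ge0 ?(ltW beta0)//.
  have Vd0 := Vdiff_ge (ltnW mm2) mm2.
  have VM : V M <= V m2 by apply: Vfun_mono; rewrite (leq_trans Mm)// ltnW.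
  rewrite (le_trans hB)// [leRHS]exprMn sqr_sqrtr; last first.
    rewrite mulr_ge0 ?sqr_ge0// (le_trans _ Vd0)// mulr_ge0 ?sqr_ge0//.
    exact/ltW/Vfun_gt0.
  have -> : (beta * eps) ^+ 2 * (sigma ^+ 2 * V M) =
     beta ^+ 2 * (sigma ^+ 2 * (eps ^+ 2 * V M)) by ring.
  rewrite !ler_pM2l ?exprn_gt0//.
  by rewrite (le_trans _ Vd0)// ler_wpM2l ?sqr_ge0.
lra.
Qed.

End SOLIT.
End Estimator.
End Candidates.

(** * Logarithmic bounds along the candidates *)

Section CandidateAsymptotics.
Variables (R : realType) (lam : nat -> R) (q : R -> R -> R) (al : nat -> R).
Variables (cmin cmax a b vartheta : R).
Hypothesis hc : 0 < cmin <= cmax.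
Hypothesis hb : 0 < b.
Hypothesis hvartheta : 0 < vartheta <= 1 / 2.
Hypothesis hdecay : forall k : nat,
    cmin * k.+1%:R `^ (- a) * expR (- (b * k.+1%:R `^ vartheta)) <= lam k /\
    lam k <= cmax * k.+1%:R `^ (- a) * expR (- (b * k.+1%:R `^ vartheta)).
Hypothesis clam : cvgn (series lam).

Lemma surrogate_lower (A : set R) (S : R -> R) : smooth_surrogate A lam S ->
  exists2 c, 0 < c & exists2 del, 0 < del &
    forall x, 0 < x < del -> c * (- ln x) ^+ 2 <= S x.
Proof.
move=> [_ _ /limf_einf_right_gt0[c1 c10 [del1 del10 H1]] _ _].
have [L0 L01 [c c0 H]] := eigenvalue_count_lower hc hb hvartheta hdecay.
exists (c1 * c); first exact: mulr_gt0.
exists (Num.min del1 (expR (- L0))); first by rewrite lt_min del10 expR_gt0.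
move=> x /andP[x0]; rewrite lt_min => /andP[xdel xL].
have L0x : L0 <= - ln x.
  by rewrite lerNr -ler_expR lnK ?posrE// ltW.
have [n cn nlam] := H _ L0x.
have nS : n%:R <= fine (Sigma lam x).
  by apply: Sigma_ge => // k /nlam; rewrite opprK lnK.
have lnx0 : 0 < (- ln x) ^+ 2.
  by rewrite exprn_gt0// (lt_le_trans _ L0x)// (lt_le_trans ltr01).
have Sig0 : 0 < fine (Sigma lam x).
  by rewrite (lt_le_trans _ nS)// (lt_le_trans _ cn)// mulr_gt0.
have := H1 x; rewrite x0 xdel => /(_ isT); rewrite ler_pdivlMr//; apply: le_trans.
by rewrite -mulrA ler_pM2l// (le_trans cn).
Qed.

Hypothesis al0 : forall m, 0 < al m.
Hypothesis al1 : forall m, al m <= expR (- 1).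

Lemma log_al_ge1 m : 1 <= - ln (al m).
Proof. by rewrite lerNr -ler_expR lnK ?posrE. Qed.

Local Notation V m := (Vfun lam q (al m)).
Hypothesis V00 : 0 < V 0%N.
Hypothesis Vmono : forall m, V 0%N <= V m.

(** The two logarithms gained from [S] outweigh the one in the denominator of the lower bound on
    [V], so one ends up in the numerator. Candidates with [al m >= del] are handled by constants,
    using [V m >= V 0]. *)
Lemma log_over_al_le (A : set R) (S : R -> R) (cv : R) : smooth_surrogate A lam S ->
  0 < cv -> (forall m, cv * (S (al m) / (- ln (al m) * al m)) <= V m) ->
  exists2 K, 0 < K & forall m, - ln (al m) / al m <= K * V m.
Proof.
move=> hS cv0 hV; have [c c0 [del del0 H]] := surrogate_lower hS.
exists ((cv * c)^-1 + `|ln del| / del / V 0%N).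
  by rewrite ltr_pwDl ?invr_gt0 ?mulr_gt0// !divr_ge0// ltW.
move=> m; have L1 := log_al_ge1 m; have L0 := lt_le_trans ltr01 L1.
have V0 : 0 <= V m := le_trans (ltW V00) (Vmono m).
have [adel|adel] := ltP (al m) del.
  rewrite (@le_trans _ _ ((cv * c)^-1 * V m))//; last first.
    by rewrite ler_wpM2r// lerDl !divr_ge0// ltW.
  rewrite ler_pdivlMl ?mulr_gt0//; apply: le_trans (hV m).
  rewrite -mulrA ler_pM2l// ler_pdivlMr ?mulr_gt0//.
  have -> : c * (- ln (al m) / al m) * (- ln (al m) * al m) = c * (- ln (al m)) ^+ 2.
    by field; rewrite gt_eqF.
  by apply: H; rewrite al0.
rewrite (@le_trans _ _ (`|ln del| / del / V 0%N * V m))//; last first.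
  by rewrite ler_wpM2r// lerDr invr_ge0 mulr_ge0// ltW.
apply: (@le_trans _ _ (`|ln del| / del)); last first.
  rewrite -[leLHS]mulr1 -[leRHS]mulrA ler_wpM2l ?divr_ge0 ?(ltW del0)//.
  by rewrite ler_pdivlMl// mulr1.
rewrite ler_pM ?invr_ge0 ?(ltW L0) ?(ltW (al0 m))//.
  by rewrite -normrN (le_trans _ (ler_norm _))// lerN2 ler_ln ?posrE.
by rewrite lef_pV2 ?posrE.
Qed.

Variable Cq : R.
Hypothesis Cq0 : 0 < Cq.
Hypothesis Val : forall m, V m <= (Cq / al m) ^+ 2 * limn (series lam).

Let Lam := limn (series lam).

Let Lam0 : 0 < Lam.
Proof.
have := lt_le_trans V00 (Val 0%N).
by rewrite pmulr_rgt0// exprn_gt0// divr_gt0.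
Qed.

Lemma ln_Vfun_le : exists2 K, 0 < K &
  forall m, ln (V m / V 0%N) <= K * - ln (al m).
Proof.
exists (`|ln (Cq ^+ 2 * Lam / V 0%N)| + 2); first by rewrite ltr_wpDl.
move=> m; have L1 := log_al_ge1 m; have L0 := lt_le_trans ltr01 L1.
have Vm0 : 0 < V m := lt_le_trans V00 (Vmono m).
have CL0 : 0 < Cq ^+ 2 * Lam / V 0%N by rewrite divr_gt0// mulr_gt0// exprn_gt0.
apply: (@le_trans _ _ (ln (Cq ^+ 2 * Lam / V 0%N * expR (2 * - ln (al m))))).
  rewrite ler_ln ?posrE ?divr_gt0// ?mulr_gt0 ?expR_gt0 ?invr_gt0//.
  rewrite ler_pdivrMr// (le_trans (Val m))//.
  have -> : expR (2 * - ln (al m)) = (al m ^+ 2)^-1.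
    by rewrite mulrN expRN mulr_natl -lnXn// lnK// posrE exprn_gt0.
  rewrite -/Lam le_eqVlt; apply/orP; left; apply/eqP; field.
  by rewrite !gt_eqF.
rewrite lnM ?posrE ?expR_gt0// expRK [leRHS]mulrDl lerD2r.
by rewrite (le_trans (ler_norm _))// ler_peMr.
Qed.

(** Applied with [s = sigma ^+ 2] at the last candidate: its parameter tends to 0 with [sigma]. *)
Lemma log_al_ge m (s : R) : 0 < s -> 1 <= s * V m ->
  - ln s / 2 - ln (Cq ^+ 2 * Lam) / 2 <= - ln (al m).
Proof.
move=> s0 sV.
have CL0 : 0 < Cq ^+ 2 * Lam by rewrite mulr_gt0// exprn_gt0.
have : al m ^+ 2 <= s * (Cq ^+ 2 * Lam).
  have := le_trans sV (ler_wpM2l (ltW s0) (Val m)).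
  rewrite -/Lam exprMn exprVn.
  have -> : s * (Cq ^+ 2 * (al m ^+ 2)^-1 * Lam) = s * (Cq ^+ 2 * Lam) / al m ^+ 2.
    by field; rewrite gt_eqF.
  by rewrite ler_pdivlMr ?exprn_gt0// mul1r.
rewrite -ler_ln ?posrE ?mulr_gt0 ?exprn_gt0//.
rewrite lnXn// lnM ?posrE// mulr2n; lra.
Qed.

End CandidateAsymptotics.

(** Filter and qualification are constrained on [[0, opnorm]], so the eigenvalues must be located
    there. As [opnorm] is a [sup], its set is first bounded by [lam 0]. *)
Lemma eigenvalue_le_opnorm (R : realType) (X : completeNormedModType R)
    (ip : {dot X for idfun}) (hip : induces_norm ip) (e : nat -> X)
    (lam : nat -> R) (A : X -> X) (heig : eigensystem ip A e lam)
    (hA : forall x k, ip (A x) (e k) = lam k * ip x (e k)) k :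
  lam k <= opnorm A.
Proof.
have [he Ae lamS lam0 _] := heig.
have lamle j : lam j <= lam 0%N.
  by elim: j => // j IH; exact: le_trans (lamS j) IH.
have ek : `|e k| = 1.
  apply/eqP; rewrite -(@sqrp_eq1 _ `|e k|)//.
  by rewrite hip he.1 eqxx.
apply: ub_le_sup.
  exists (lam 0%N) => _ [x /= x1 <-].
  apply: (@le_trans _ _ (lam 0%N * `|x|)); last by rewrite ler_piMr// ltW.
  apply: (norm_le_coef hip he); first exact: ltW.
  by move=> j; rewrite hA normrM ger0_norm ?(ltW (lam0 j))// ler_wpM2r.
by exists (e k); rewrite /= ?ek// Ae normrZ ek mulr1 gtr0_norm.
Qed.

(** * The risk *)

Section ExpectationBound.
Variables (R : realType) (d : measure_display) (Omega : measurableType d).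
Variables (P : probability Omega R) (loss : Omega -> R) (D : nat -> Omega -> R).
Variables (E : nat -> nat -> set Omega) (V r : nat -> R) (M n : nat).
Variables (c0 s V0 : R).
Hypotheses (loss0 : forall w, 0 <= loss w) (c00 : 0 <= c0) (s0 : 0 <= s).
Hypotheses (mD : forall m, measurable_fun setT (D m)).
Hypotheses (D0 : forall m w, 0 <= D m w) (mE : forall m m2, measurable (E m m2)).
Hypotheses (V_gt0 : forall m, 0 < V m) (r_gt0 : forall m, 0 < r m).
Hypothesis rV : forall m, r m * V m <= V0.
Hypothesis ED : forall m, (\int[P]_w (D m w)%:E <= (8 * V m)%:E)%E.
Hypothesis ED2 : forall m, (\int[P]_w (D m w ^+ 2)%:E <= (128 * V m ^+ 2)%:E)%E.
Hypothesis PE : forall m m2, (m < m2)%N -> (P (E m m2) <= (r m.+1 ^+ 2)%:E)%E.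
Hypothesis lossP : {ae P, forall w,
  loss w <= c0 + 4 * (s * D M w) \/
  exists m, [/\ (M <= m)%N, (m < n)%N, loss w <= c0 + 2 * (s * D m.+1 w) &
    exists2 m2, (m < m2 <= n)%N & E m m2 w]}.

(** [r m] plays the square root of the probability of a late stop. With this weight both parts of
    [g] have expectation of order [r m * V m], which is at most [V0]. *)
Let del m := r m / V m.

Let del0 m : 0 < del m. Proof. by rewrite divr_gt0. Qed.

(** [2 * D * 1_E <= del * D ^ 2 + 1_E / del]: this replaces a Cauchy-Schwarz
    argument for [E[D 1_E]]. *)
Let g m w := s * del m.+1 * D m.+1 w ^+ 2 +
  s / del m.+1 * \sum_(m.+1 <= m2 < n.+1) \1_(E m m2) w.

Let S0 m w : 0 <= \sum_(m.+1 <= m2 < n.+1) \1_(E m m2) w :> R.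
Proof. by apply: sumr_ge0 => m2 _; rewrite indicE. Qed.

Let g0 m w : 0 <= g m w.
Proof.
have d0 := ltW (del0 m.+1).
apply: addr_ge0; apply: mulr_ge0; rewrite ?sqr_ge0 ?S0//.
  exact: mulr_ge0.
exact: divr_ge0.
Qed.

Let mS m : measurable_fun setT (fun w => \sum_(m.+1 <= m2 < n.+1) \1_(E m m2) w : R).
Proof. by apply: measurable_sum => m2; exact: measurable_indic. Qed.

Let mg m : measurable_fun setT (g m).
Proof.
apply: measurable_funD; apply: measurable_funM => //.
exact: measurable_funX.
Qed.

Let Eg m : (\int[P]_w (g m w)%:E <= (s * (128 + n%:R) * V0)%:E)%E.
Proof.
have sd0 : 0 <= s * del m.+1 by rewrite mulr_ge0// ltW.
have sd0' : 0 <= s / del m.+1 by rewrite divr_ge0// ltW.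
have gE w : (g m w)%:E = ((s * del m.+1)%:E * (D m.+1 w ^+ 2)%:E +
    (s / del m.+1)%:E * (\sum_(m.+1 <= m2 < n.+1) \1_(E m m2) w)%:E)%E.
  by rewrite -!EFinM -EFinD.
under eq_integral do rewrite gE.
rewrite ge0_integralD//; last 4 first.
- by move=> w _; rewrite mule_ge0 ?lee_fin ?sqr_ge0.
- by apply: measurable_funeM; apply/measurable_EFinP; exact: measurable_funX.
- by move=> w _; rewrite -EFinM lee_fin mulr_ge0.
- by apply: measurable_funeM; apply/measurable_EFinP.
rewrite ge0_integralZl//; last 2 first.
- by apply/measurable_EFinP; exact: measurable_funX.
- by move=> w _; rewrite lee_fin sqr_ge0.
rewrite ge0_integralZl//; last 2 first.
- exact/measurable_EFinP.
- by move=> w _; rewrite lee_fin.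
have ES : (\int[P]_w (\sum_(m.+1 <= m2 < n.+1) \1_(E m m2) w)%:E <=
    (n%:R * r m.+1 ^+ 2)%:E)%E.
  under eq_integral do rewrite -sumEFin.
  rewrite ge0_integral_sum//; last first.
    by move=> m2; apply/measurable_EFinP; exact: measurable_indic.
  apply: (@le_trans _ _ (\sum_(m.+1 <= m2 < n.+1) (r m.+1 ^+ 2)%:E)%E).
    rewrite big_nat [leRHS]big_nat; apply: lee_sum => m2 /andP[mm2 _].
    by rewrite integral_indic// setIT PE.
  rewrite sumEFin lee_fin big_const_nat iter_addr addr0 -[leLHS]mulr_natl.
  by rewrite ler_wpM2r ?sqr_ge0// ler_nat subSS leq_subr.
apply: (@le_trans _ _ ((s * del m.+1)%:E * (128 * V m.+1 ^+ 2)%:E +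
    (s / del m.+1)%:E * (n%:R * r m.+1 ^+ 2)%:E)%E).
  by apply: leeD; apply: lee_wpmul2l; rewrite ?lee_fin.
rewrite -!EFinM -EFinD lee_fin.
have -> : s * del m.+1 * (128 * V m.+1 ^+ 2) + s / del m.+1 * (n%:R * r m.+1 ^+ 2) =
   s * (128 + n%:R) * (r m.+1 * V m.+1).
  by rewrite /del; field; rewrite !gt_eqF.
by rewrite ler_wpM2l// mulr_ge0// addr_ge0.
Qed.

(** The index [m] of a late stop and the index [m2] that rejected it are random; summing over both
    costs a factor of order [n] each, which is affordable because [n] is logarithmic in [sigma]. *)
Lemma expectation_le :
  (\int[P]_w (loss w)%:E <=
    (c0 + 32 * (s * V M) + n%:R * (s * (128 + n%:R) * V0))%:E)%E.
Proof.
pose G w := (c0%:E + ((4 * s)%:E * (D M w)%:E + \sum_(M <= m < n) (g m w)%:E))%E.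
have mG1 : measurable_fun setT (fun w => (4 * s)%:E * (D M w)%:E)%E.
  by apply: measurable_funeM; exact/measurable_EFinP.
have mG2 : measurable_fun setT (fun w => \sum_(M <= m < n) (g m w)%:E)%E.
  by apply: emeasurable_sum => m; exact/measurable_EFinP.
have s40 : 0 <= 4 * s by rewrite mulr_ge0.
have G10 w : (0 <= (4 * s)%:E * (D M w)%:E)%E by rewrite mule_ge0 ?lee_fin.
have G20 w : (0 <= \sum_(M <= m < n) (g m w)%:E)%E.
  by apply: sume_ge0 => m _; rewrite lee_fin.
have V00 : 0 <= V0 by rewrite (le_trans _ (rV 0%N))// mulr_ge0// ltW.
apply: (@le_trans _ _ (\int[P]_w G w)%E).
  apply: ae_le_integral_nonmeasurable.
  - by move=> w; rewrite lee_fin.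
  - by move=> w; rewrite adde_ge0 ?lee_fin// adde_ge0.
  - by apply: emeasurable_funD => //; exact: emeasurable_funD.
  apply: filterS lossP => w; rewrite /G sumEFin -EFinM -!EFinD lee_fin.
  have Sg0 : 0 <= \sum_(M <= m < n) g m w by apply: sumr_ge0.
  move=> [lw|[m [Mm mn lw [m2 /andP[mm2 m2n] Ew]]]].
    by rewrite (le_trans lw)// lerD2l mulrA lerDl.
  rewrite (le_trans lw)// lerD2l.
  apply: (@le_trans _ _ (\sum_(M <= m < n) g m w)); last first.
    by rewrite lerDr mulr_ge0.
  rewrite (bigD1_seq m)/= ?mem_index_iota ?Mm ?iota_uniq//.
  apply: (@le_trans _ _ (g m w)); last by rewrite lerDl sumr_ge0.
  have ind1 : 1 <= \sum_(m.+1 <= m2 < n.+1) \1_(E m m2) w :> R.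
    rewrite (bigD1_seq m2)/= ?mem_index_iota ?iota_uniq ?mm2//.
    by rewrite indicE mem_set//= lerDl sumr_ge0.
  have d0 := del0 m.+1.
  rewrite /g; apply: (@le_trans _ _ (s * del m.+1 * D m.+1 w ^+ 2 + s / del m.+1)).
    have -> : s * del m.+1 * D m.+1 w ^+ 2 + s / del m.+1 =
      s * ((del m.+1 * D m.+1 w - 1) ^+ 2 / del m.+1 + 2 * D m.+1 w).
      by field; rewrite gt_eqF.
    by rewrite mulrCA ler_wpM2l// lerDr divr_ge0 ?sqr_ge0 ?ltW.
  by rewrite lerD2l ler_peMr// divr_ge0// ltW.
rewrite /G ge0_integralD//; last 2 first.
- by move=> w _; rewrite adde_ge0.
- exact: emeasurable_funD.
have -> : (\int[P]_w c0%:E)%E = c0%:E.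
  rewrite integral_cst// -[RHS]mule1; congr (_ * _)%E.
  exact: probability_setT.
rewrite ge0_integralD//.
rewrite ge0_integralZl//; last 2 first.
- exact/measurable_EFinP.
- by move=> w _; rewrite lee_fin.
rewrite ge0_integral_sum//; last 2 first.
- by move=> m; exact/measurable_EFinP.
- by move=> m w _; rewrite lee_fin.
rewrite -addrA !EFinD leeD2l//; apply: leeD.
  apply: (@le_trans _ _ ((4 * s)%:E * (8 * V M)%:E)%E).
    by apply: lee_wpmul2l; rewrite ?lee_fin.
  by rewrite -EFinM lee_fin; lra.
apply: (@le_trans _ _ (\sum_(M <= m < n) (s * (128 + n%:R) * V0)%:E)%E).
  by apply: lee_sum.
rewrite sumEFin lee_fin big_const_nat iter_addr addr0 -[leLHS]mulr_natl.
rewrite ler_wpM2r ?ler_nat ?leq_subr// !mulr_ge0// addr_ge0//.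
Qed.

End ExpectationBound.

(** * Noise moments, quantiles and thresholds *)

Section NoiseCandidates.
Variables (R : realType) (d : measure_display) (Omega : measurableType d).
Variables (P : probability Omega R) (X Y : completeNormedModType R).
Variables (ipX : {dot X for idfun}) (ipY : {dot Y for idfun}).
Hypothesis hipX : induces_norm ipX.
Variables (T : {linear X -> Y}) (Tadj : Y -> X).
Hypothesis hTadj : is_adjoint ipX ipY T Tadj.
Variables (e : nat -> X) (lam : nat -> R).
Hypothesis heig : eigensystem ipX (Tadj \o T) e lam.
Variable Z : Y -> {RV P >-> R}.
Hypothesis hZ : standard_gaussian_process ipY Z.
Variable TZ : Omega -> X.
Hypothesis hTZ : adjoint_version P ipX T Z TZ.
Variables (q : R -> R -> R) (al : nat -> R) (Cq theta1 theta2 : R).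
Hypotheses (Cq0 : 0 < Cq) (al0 : forall m, 0 < al m).
Hypothesis q0 : forall m k, 0 <= q (al m) (lam k).
Hypothesis qC : forall m k, al m * q (al m) (lam k) <= Cq.
Hypothesis q1 : forall m k, lam k * q (al m) (lam k) <= 1.
Hypothesis qmono : forall m m' k, (m <= m')%N ->
  q (al m) (lam k) <= q (al m') (lam k).
Hypothesis theta : 1 < theta1.
Hypothesis Vratio : forall m,
  theta1 <= Vfun lam q (al m.+1) / Vfun lam q (al m) <= theta2.

Local Notation V m := (Vfun lam q (al m)).
Local Notation Vd m1 m2 := (Vdiff lam q (al m1) (al m2)).
Local Notation D m w := (`|fhat ipX e lam q (al m) (TZ w)| ^+ 2).

Let he : orthonormal_basis ipX e. Proof. by case: heig. Qed.
Let lam0 k : 0 < lam k. Proof. by case: heig. Qed.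
Let clam : cvgn (series lam). Proof. by case: heig. Qed.

Let Vgt0 m : 0 < V m.
Proof. by apply: (Vfun_gt0 lam0 clam Cq0 al0 q0 qC theta Vratio). Qed.

Lemma measurable_noise m : measurable_fun setT (fun w => D m w).
Proof.
apply: (measurable_fcalc_sqnorm hipX he (M := Cq / al m)).
  exact: (filter_norm_le al0 q0 qC).
by case: hTZ.
Qed.

Let noise_exp m :
  (\int[P]_w (expR (D m w / (4 * V m)))%:E <= (expR (V m / (2 * V m)))%:E)%E.
Proof.
apply: (fcalc_noise_exp_moment hipX hTadj heig hZ hTZ (M := Cq / al m)) => //.
- exact: (filter_norm_le al0 q0 qC).
- move=> k; apply: le_trans (Vfun_partial lam0 clam Cq0 al0 q0 qC m k.+1).
  rewrite big_nat_recr//= lerDr sumr_ge0// => j _.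
  by rewrite mulr_ge0 ?sqr_ge0// ltW.
- by move=> N; exact: (Vfun_partial lam0 clam Cq0 al0 q0 qC).
Qed.

Lemma noise_first_moment m : (\int[P]_w (D m w)%:E <= (8 * V m)%:E)%E.
Proof.
by apply: (first_moment_le (measurable_noise m) _ (Vgt0 m) (noise_exp m)) => w;
  rewrite sqr_ge0.
Qed.

Lemma noise_second_moment m : (\int[P]_w (D m w ^+ 2)%:E <= (128 * V m ^+ 2)%:E)%E.
Proof.
by apply: (second_moment_le (measurable_noise m) _ (Vgt0 m) (noise_exp m)) => w;
  rewrite sqr_ge0.
Qed.

Lemma noise_diffE m1 m2 h : noise_diff ipX e lam q al m1 m2 h =
  `|fcalc ipX e lam (fun x => q (al m1) x - q (al m2) x) h|.
Proof. by rewrite /noise_diff (fhat_diff al0 q0 qC hipX he). Qed.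

Let diff_norm m1 m2 k :
  `|q (al m1) (lam k) - q (al m2) (lam k)| <= Cq / al m1 + Cq / al m2.
Proof. by rewrite (le_trans (ler_normB _ _))// lerD// (filter_norm_le al0 q0 qC). Qed.

Lemma measurable_noise_diff m1 m2 :
  measurable_fun setT (fun w => noise_diff ipX e lam q al m1 m2 (TZ w)).
Proof.
rewrite (_ : (fun w => _) = (fun w => Num.sqrt (`|fcalc ipX e lam
    (fun x => q (al m1) x - q (al m2) x) (TZ w)| ^+ 2))); last first.
  by apply/funext => w; rewrite noise_diffE sqrtr_sqr normr_id.
apply: measurableT_comp.
  apply: continuous_measurable_fun.
  exact: sqrt_continuous.
apply: (measurable_fcalc_sqnorm hipX he (M := Cq / al m1 + Cq / al m2)) => //.
by case: hTZ.
Qed.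

Variable z : nat -> nat -> R -> R.
Hypothesis hz : tail_quantile P
    (fun m1 m2 w => noise_diff ipX e lam q al m1 m2 (TZ w)) z.

(** The deviation term carries the largest single term [Cq / al m2] instead of the whole variance;
    it comes from [lam k * q^2 <= q <= Cq / al m2]. *)
Lemma quantile_sqr_le m1 m2 x : (m1 < m2)%N -> 0 < x -> 0 <= z m1 m2 x ->
  z m1 m2 x ^+ 2 <= 2 * Vd m1 m2 + 4 * (Cq / al m2) * x.
Proof.
move=> m12 x0 zx0.
have A0 : 0 < Cq / al m2 by rewrite divr_gt0.
apply: (@tail_quantile_sqr_le _ _ _ P
   (fun w => `|fcalc ipX e lam (fun x => q (al m1) x - q (al m2) x) (TZ w)| ^+ 2)
   _ (fun w => noise_diff ipX e lam q al m1 m2 (TZ w))) => //.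
- apply: (measurable_fcalc_sqnorm hipX he (M := Cq / al m1 + Cq / al m2)) => //.
  by case: hTZ.
- by move=> w; rewrite noise_diffE.
- by move=> w; rewrite noise_diffE.
- exact: measurable_noise_diff.
- apply: (fcalc_noise_exp_moment hipX hTadj heig hZ hTZ (M := Cq / al m1 + Cq / al m2)) => //.
  + exact: (Vdiff_term_le lam0 al0 q0 qC q1 qmono (ltnW m12)).
  + exact: (Vdiff_partial lam0 clam Cq0 al0 q0 qC qmono (ltnW m12)).
- exact: hz.
Qed.

Variables (beta gamma K1 K2 : R).
Hypotheses (beta0 : 0 < beta) (gamma0 : 0 < gamma).
Hypothesis lnV : forall m, ln (V m / V 0%N) <= K1 * - ln (al m).
Hypothesis logal : forall m, - ln (al m) / al m <= K2 * V m.
Hypotheses (K10 : 0 < K1) (K20 : 0 < K2).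

Definition eta_const : R :=
  2 * (2 + 4 * Cq * (2 * (1 + gamma)) * K1 * K2) + 2 * beta ^+ 2.

(** [tail_quantile] speaks of [x > 0] only. The index [m.+1] in [x_m] makes the ratio at least
    [theta1 > 1], even for [m = 0]. *)
Lemma xm_gt0 sigma m : 0 < sigma -> 0 < xm lam q al sigma gamma m.
Proof.
move=> s0; have s2 : 0 < sigma ^+ 2 by rewrite exprn_gt0.
rewrite /xm /vm -mulf_div divff ?gt_eqF// mul1r.
rewrite mulr_gt0 ?mulr_gt0 ?addr_gt0// ln_gt0//.
rewrite ltr_pdivlMr// mul1r.
have h1 : theta1 * V 0%N <= V m.+1.
  exact: (Vfun_theta1 lam0 clam Cq0 al0 q0 qC theta Vratio).
by rewrite (lt_le_trans _ h1)// ltr_pMl.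
Qed.

Lemma eta_le sigma m1 m2 : 0 < sigma -> (m1 < m2)%N ->
  Defs.eta lam q al z beta gamma sigma m1 m2 <=
    Num.sqrt (eta_const * (sigma ^+ 2 * V m2)).
Proof.
move=> s0 m12; rewrite /Defs.eta; set x := xm _ _ _ _ _ _.
have s2 : 0 < sigma ^+ 2 by rewrite exprn_gt0.
have x0 : 0 < x := xm_gt0 m1 s0.
(* The positive part makes it unnecessary to decide the sign of the quantile before squaring. *)
pose zp := Num.max (z m1 m2 x) 0.
have zp0 : 0 <= zp by rewrite le_max lexx orbT.
have Vd0 : 0 <= Vd m1 m2.
  have := Vdiff_partial lam0 clam Cq0 al0 q0 qC qmono (ltnW m12) 0.
  by rewrite big_geq.
have VdV : Vd m1 m2 <= V m2.
  exact: (Vdiff_le lam0 clam Cq0 al0 q0 qC qmono (ltnW m12)).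
have g1 : 0 < 2 * (1 + gamma) by rewrite mulr_gt0// addr_gt0.
have zp2 : zp ^+ 2 <= (2 + 4 * Cq * (2 * (1 + gamma)) * K1 * K2) * V m2.
  rewrite mulrDl.
  have c0 : 0 <= 4 * Cq * (2 * (1 + gamma)) * K1 * K2 * V m2.
    by rewrite !mulr_ge0 ?addr_ge0 ?(ltW Cq0) ?(ltW K10) ?(ltW K20)
      ?(ltW gamma0) ?(ltW (Vgt0 _)).
  have V2 : 0 <= V m2 by exact: ltW.
  rewrite /zp; case: (leP (z m1 m2 x) 0) => [_|/ltW z0].
    by rewrite expr0n/= addr_ge0// mulr_ge0.
  rewrite (le_trans (quantile_sqr_le m12 x0 z0))//.
  rewrite lerD ?ler_pM2l//.
  (* [x] contains [V m1.+1], and [m1 < m2] gives [V m1.+1 <= V m2]. So the logarithm is taken at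
     [al m2], as [logal] requires to absorb it together with [1 / al m2]. *)
  have xle : x <= 2 * (1 + gamma) * (K1 * - ln (al m2)).
    rewrite /x /xm /vm -mulf_div divff ?gt_eqF// mul1r ler_pM2l//.
    rewrite (le_trans _ (lnV m2))// ler_ln ?posrE ?divr_gt0//.
    rewrite ler_pM2r ?invr_gt0//.
    exact: (Vfun_mono lam0 clam Cq0 al0 q0 qC theta Vratio).
  apply: (@le_trans _ _ (4 * (Cq / al m2) * (2 * (1 + gamma) * (K1 * - ln (al m2))))).
    by rewrite ler_pM2l// mulr_gt0// divr_gt0.
  have -> : 4 * (Cq / al m2) * (2 * (1 + gamma) * (K1 * - ln (al m2))) =
    4 * Cq * (2 * (1 + gamma)) * K1 * (- ln (al m2) / al m2).
    by field; rewrite gt_eqF.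
  by rewrite -[leRHS]mulrA ler_wpM2l// !mulr_ge0 ?addr_ge0 ?(ltW Cq0) ?(ltW K10)
    ?(ltW K20) ?(ltW gamma0) ?(ltW (Vgt0 _)).
apply: (@le_trans _ _ (sigma * zp + beta * Num.sqrt (sigma ^+ 2 * Vd m1 m2))).
  by rewrite lerD2r ler_pM2l// le_max lexx.
rewrite -[leLHS]ger0_norm; last first.
  by rewrite addr_ge0// mulr_ge0 ?sqrtr_ge0 ?(ltW s0) ?(ltW beta0).
rewrite -sqrtr_sqr ler_wsqrtr//.
set u := sigma * zp; set v := beta * Num.sqrt _.
have v2 : v ^+ 2 <= beta ^+ 2 * (sigma ^+ 2 * V m2).
  rewrite exprMn sqr_sqrtr; last by rewrite mulr_ge0// ltW.
  by rewrite ler_wpM2l ?sqr_ge0// ler_pM2l.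
have u2 : u ^+ 2 <= (2 + 4 * Cq * (2 * (1 + gamma)) * K1 * K2) * (sigma ^+ 2 * V m2).
  by rewrite exprMn [leRHS]mulrCA ler_pM2l.
have := sqr_ge0 (u - v).
rewrite /eta_const; lra.
Qed.

End NoiseCandidates.

(** One index before [mmax] the variance is still below 1, although [V] has grown like a power of
    [theta1]. *)
Lemma mmax_le_log (R : realType) (lam : nat -> R) (q : R -> R -> R) (al : nat -> R)
    (theta1 : R) : 1 < theta1 -> 0 < Vfun lam q (al 0%N) ->
  (forall m, theta1 ^+ m * Vfun lam q (al 0%N) <= Vfun lam q (al m)) ->
  exists2 C, 0 < C & forall sigma, 0 < sigma -> 1 <= - ln (sigma ^+ 2) ->
    (forall j, (1 <= j < mmax lam q al sigma)%N ->
      sigma ^+ 2 * Vfun lam q (al j) < 1) ->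
    (mmax lam q al sigma)%:R <= C * - ln (sigma ^+ 2).
Proof.
move=> theta V00 Vexp; set V0 := Vfun lam q (al 0%N) in V00 Vexp *.
have lnt : 0 < ln theta1 by rewrite ln_gt0.
exists (1 + (1 + `|ln V0|) / ln theta1).
  by rewrite ltr_pwDl// divr_ge0 ?(ltW lnt)// addr_ge0.
move=> sigma s0 Lam1; set n := mmax _ _ _ _; set Lam := - ln _ in Lam1 * => nP.
have Lam0 : 0 < Lam := lt_le_trans ltr01 Lam1.
(* For [n <= 1] the predecessor is not a positive index, and the minimality of [mmax] says nothing
   about it. *)
have [n1|n1] := leqP n 1.
  apply: (@le_trans _ _ Lam).
    by apply: le_trans Lam1; rewrite (ler_nat R n 1).
  rewrite ler_peMl ?(ltW Lam0)//.
  by rewrite lerDl divr_ge0 ?(ltW lnt)// addr_ge0.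
have [j nj] : exists j, n = j.+1 by exists n.-1; rewrite prednK// (ltn_trans _ n1).
have vj : sigma ^+ 2 * (theta1 ^+ j * V0) < 1.
  apply: le_lt_trans (nP j _); first by rewrite ler_pM2l ?exprn_gt0.
  by move: n1; rewrite nj !ltnS => ->; rewrite leqnn.
have t0 : 0 < theta1 := lt_trans ltr01 theta.
have jle : j%:R * ln theta1 <= Lam + `|ln V0|.
  have : ln (sigma ^+ 2 * (theta1 ^+ j * V0)) <= 0.
    by rewrite ln_le0// ltW.
  rewrite lnM ?posrE ?mulr_gt0 ?exprn_gt0// lnM ?posrE ?exprn_gt0//.
  rewrite lnXn// -mulr_natl /Lam.
  have := ler_norm (- ln V0); rewrite normrN; lra.
rewrite nj -natr1 mulrDl mul1r [leLHS]addrC lerD//.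
rewrite mulrAC ler_pdivlMr// (le_trans jle)// mulrDl mul1r lerD2l.
by rewrite ler_peMr.
Qed.

Lemma source_coef (R : realType) (X : completeNormedModType R)
    (ip : {dot X for idfun}) (hip : induces_norm ip) (e : nat -> X)
    (he : orthonormal_basis ip e) (lam : nat -> R) (nu tau : R) :
  0 < nu \/ (nu = 0 /\ 0 < tau) -> (forall k, 0 < lam k) ->
  (forall k, lam k <= expR (- 1)) -> (forall k, lam k <= lam 0%N) ->
  forall g k, ip (fcalc ip e lam (phi_log nu tau) g) (e k) =
    phi_log nu tau (lam k) * ip g (e k).
Proof.
move=> hnutau lam0 lam1 lamle g k.
have [K K1 HK] := phi_exp_quasi_decreasing hnutau.
apply: (fcalc_coef hip he (M := K * phi_exp nu tau (- ln (lam 0%N)))) => j.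
rewrite phi_logE// ger0_norm ?phi_exp_ge0//; apply: HK.
  by rewrite lerNr -ler_expR lnK ?posrE.
by rewrite lerN2 ler_ln ?posrE.
Qed.

(** Both [W] and [TZ] are characterised up to null sets that depend on the test vector. The basis is
    countable, so the identities for all [e k] hold on one set of full probability. *)
Lemma observation_eq (R : realType) (d : measure_display)
    (Omega : measurableType d) (P : probability Omega R)
    (X Y : completeNormedModType R)
    (ipX : {dot X for idfun}) (ipY : {dot Y for idfun})
    (hipX : induces_norm ipX) (T : {linear X -> Y}) (Tadj : Y -> X)
    (hTadj : is_adjoint ipX ipY T Tadj) (e : nat -> X)
    (he : orthonormal_basis ipX e) (Z : Y -> {RV P >-> R})
    (TZ : Omega -> X) (hTZ : adjoint_version P ipX T Z TZ) (f : X) (sigma : R)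
    (W : Omega -> X) :
  adjoint_version P ipX T (observation ipY T Z f sigma) W ->
  {ae P, forall w, W w = Tadj (T f) + sigma *: TZ w}.
Proof.
move=> [_ hW]; have [_ hZ] := hTZ.
have : {ae P, forall w, forall k, ipX (W w) (e k) = observation ipY T Z f sigma (T (e k)) w
    /\ ipX (TZ w) (e k) = Z (T (e k)) w}.
  apply: ae_foralln => k; move: (hW (e k)) (hZ (e k)); apply: filterS2.
  by move=> w -> ->.
apply: filterS => w H; apply: (coef_inj he) => k.
have [-> Zk] := H k.
by rewrite ipDl ipZl Zk /observation [in LHS]ipC hTadj [in LHS]ipC.
Qed.

Theorem theorem4p3 (R : realType) (d : measure_display)
  (Omega : measurableType d) (P : probability Omega R)
  (X Y : completeNormedModType R)
  (ipX : {dot X for idfun}) (ipY : {dot Y for idfun})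
  (hipX : induces_norm ipX) (hipY : induces_norm ipY)
  (sepX : separable X) (sepY : separable Y)
  (T : {linear X -> Y}) (Tadj : Y -> X)
  (Tinj : injective T) (THS : hilbert_schmidt ipX T)
  (hTadj : is_adjoint ipX ipY T Tadj)
  (e : nat -> X) (lam : nat -> R)
  (heig : eigensystem ipX (Tadj \o T) e lam)
  (hlam1 : lam 0%N <= expR (- 1))
  (Z : Y -> {RV P >-> R}) (hZ : standard_gaussian_process ipY Z)
  (TZ : Omega -> X) (hTZ : adjoint_version P ipX T Z TZ)
  (TY : X -> R -> Omega -> X)
  (hTY : forall (f : X) (sigma : R), 0 < sigma ->
    adjoint_version P ipX T (observation ipY T Z f sigma) (TY f sigma))
  (cmin cmax a b vartheta : R)
  (hc : 0 < cmin <= cmax) (hb : 0 < b) (hvartheta : 0 < vartheta <= 1 / 2)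
  (hdecay : forall k : nat,
    cmin * k.+1%:R `^ (- a) * expR (- (b * k.+1%:R `^ vartheta)) <= lam k /\
    lam k <= cmax * k.+1%:R `^ (- a) * expR (- (b * k.+1%:R `^ vartheta)))
  (nu tau rho : R)
  (hnutau : 0 < nu \/ (nu = 0 /\ 0 < tau)) (hrho : 0 < rho)
  (A : set R) (hA0 : forall alpha, A alpha -> 0 < alpha)
  (hA : limit_point A 0)
  (q : R -> R -> R) (hq : ordered_filter A (opnorm (Tadj \o T)) q)
  (hqual : qualification A (opnorm (Tadj \o T)) (lam 0%N) q (phi_log nu tau))
  (S : R -> R) (hS : smooth_surrogate A lam S)
  (theta1 theta2 : R) (al : nat -> R)
  (hal : candidate_sequence A lam q theta1 theta2 al)
  (hal1 : forall m, al m <= lam 0%N)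
  (cv : R) (hcv : 0 < cv)
  (hvar : forall (sigma : R) (m : nat), 0 < sigma ->
    cv * sigma ^+ 2 * (S (al m) / (- ln (al m) * al m)) <= vm lam q al sigma m)
  (beta gamma : R) (hbeta : 0 < beta) (hgamma : 0 < gamma)
  (z : nat -> nat -> R -> R)
  (hz : tail_quantile P
    (fun m1 m2 w => noise_diff ipX e lam q al m1 m2 (TZ w)) z) :
  exists2 C : R, 0 < C &
    exists2 sigma0 : R, 0 < sigma0 &
      forall sigma : R, 0 < sigma < sigma0 ->
        (ereal_sup
          [set 'E_P[(fun w : Omega =>
             `|fhat ipX e lam q
                 (al (solit ipX e lam q al z beta gamma sigma (TY f sigma w)))
                 (TY f sigma w) - f| ^+ 2)%R]
          | f in source_set ipX e lam (phi_log nu tau) rho]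
        <= (C * (sigma ^+ 2) `^ (2 * nu / (2 * nu + 1))
              * (- ln (sigma ^+ 2))
                  `^ ((2 * nu / vartheta - 2 * tau) / (2 * nu + 1)))%:E)%E.
Proof.
have [he Ae lamS lam0 clam] := heig.
have lamle k : lam k <= lam 0%N.
  by elim: k => // k IH; exact: le_trans (lamS k) IH.
have lam1 k : lam k <= expR (- 1) := le_trans (lamle k) hlam1.
pose Af x := Tadj (T x).
have hAf : forall x k, ipX (Af x) (e k) = lam k * ipX x (e k).
  exact: (adjoint_coef hTadj heig).
have lamL k : 0 <= lam k <= opnorm (Tadj \o T).
  by rewrite (ltW (lam0 k)) (eigenvalue_le_opnorm hipX heig).
have [q0' [Cq' HCq] qmono'] := hq.
pose Cq := Num.max Cq' 1.
have Cq0 : 0 < Cq by rewrite lt_max ltr01 orbT.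
have [/andP[theta _] alA alS Vratio] := hal.
have al0 m : 0 < al m := hA0 _ (alA m).
have almono m m' : (m <= m')%N -> al m' <= al m.
  elim: m' => [|m' IH]; first by rewrite leqn0 => /eqP ->.
  rewrite leq_eqVlt => /predU1P[->//|/IH h]; apply: le_trans h.
  exact/ltW/alS.
have al1 m : al m <= expR (- 1) := le_trans (hal1 m) hlam1.
have q0 m k : 0 <= q (al m) (lam k) by exact: q0'.
have qC m k : al m * q (al m) (lam k) <= Cq.
  by have [h _] := HCq _ _ (alA m) (lamL k); rewrite (le_trans h)// le_max lexx.
have q1 m k : lam k * q (al m) (lam k) <= 1.
  by have [_] := HCq _ _ (alA m) (lamL k).
have qmono m m' k : (m <= m')%N -> q (al m) (lam k) <= q (al m') (lam k).
  by move=> mm'; apply: qmono' => //; exact: almono.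
pose V m := Vfun lam q (al m).
have Vgt0 m : 0 < V m := Vfun_gt0 lam0 clam Cq0 al0 q0 qC theta Vratio m.
have Vmono m m' : (m <= m')%N -> V m <= V m'.
  exact: (Vfun_mono lam0 clam Cq0 al0 q0 qC theta Vratio).
have Vexp m : theta1 ^+ m * V 0%N <= V m.
  exact: (Vfun_exp lam0 clam Cq0 al0 q0 qC theta Vratio).
have Val m : V m <= (Cq / al m) ^+ 2 * limn (series lam).
  exact: (Vfun_al lam0 clam Cq0 al0 q0 qC).
pose L m := - ln (al m).
have L1 m : 1 <= L m by exact: log_al_ge1.
have hV m : cv * (S (al m) / (- ln (al m) * al m)) <= V m.
  by have := hvar 1 m ltr01; rewrite /vm expr1n mul1r mulr1.
have [K1 K10 lnV] := ln_Vfun_le al0 al1 (Vgt0 0%N) (fun m => Vmono 0%N m (leq0n m)) Cq0 Val.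
have [K2 K20 logal] := log_over_al_le hc hb hvartheta hdecay clam al0 al1
  (Vgt0 0%N) (fun m => Vmono 0%N m (leq0n m)) hS hcv hV.
have [KV KV0 HKV] := filter_variance_upper hc hb hvartheta hdecay (ltW Cq0).
have alE m : expR (- L m) = al m by rewrite /L opprK lnK ?posrE.
have Vupper m : V m <= KV * L m `^ vartheta^-1 * expR (L m).
  apply: (Vfun_le lam0) => N.
  by apply: (HKV (fun k => q (al m) (lam k))) => // k; rewrite alE.
have [Cf HCf] := hqual.
pose Cphi := Num.max Cf 1.
have Cphi0 : 0 < Cphi by rewrite lt_max ltr01 orbT.
pose bm m := Cphi * phi_exp nu tau (L m) * rho.
have bm0 m : 0 <= bm m.
  by rewrite mulr_ge0 ?(ltW hrho)// mulr_ge0 ?phi_exp_ge0 ?(ltW Cphi0).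
have bias_le m f : source_set ipX e lam (phi_log nu tau) rho f ->
    `|bias lam q al ipX e Af m f| <= bm m.
  move=> [g grho ->].
  apply: (@le_trans _ _ (Cphi * phi_exp nu tau (L m) * `|g|)); last first.
    by rewrite ler_wpM2l// mulr_ge0 ?phi_exp_ge0// ltW.
  apply: (norm_le_coef hipX he); first by rewrite mulr_ge0 ?phi_exp_ge0// ltW.
  move=> k; rewrite (bias_coef al0 q0 qC hipX he hAf).
  rewrite (source_coef hipX he hnutau lam0 lam1 lamle) mulrA normrM.
  rewrite ler_wpM2r// normrM ger0_norm ?subr_ge0// ger0_norm; last first.
    by rewrite phi_logE// phi_exp_ge0.
  rewrite mulrC; have alP : 0 < al m <= lam 0%N by rewrite al0 hal1.
  apply: (le_trans (HCf _ (alA m) alP _ (lamL k))).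
  by rewrite phi_logE// ler_wpM2r ?phi_exp_ge0// le_max lexx.
pose eps := (1 - theta1^-1) / 2.
have eps0 : 0 < eps by rewrite divr_gt0// subr_gt0 invf_lt1// (lt_trans ltr01).
pose kap := beta * eps.
have kap0 : 0 < kap by rewrite mulr_gt0.
have vt0 : 0 < vartheta^-1 by rewrite invr_gt0; case/andP: hvartheta.
have [K3 K30 HK3] := noise_le_rate hnutau vartheta^-1.
have K40 : 0 < (Cphi * rho) ^+ 2 / kap ^+ 2.
  by rewrite divr_gt0 ?exprn_gt0// mulr_gt0.
have [C4 C40 [Lam0 Lam01 Hrate]] := balanced_le_rate hnutau vt0 KV0 K40.
have [Cm Cm0 Hmmax] := mmax_le_log theta (Vgt0 0%N) Vexp.
have eps1 : 0 < kap / (Cphi * rho) by rewrite divr_gt0// mulr_gt0.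
have [l0 l01 Hl0] := phi_exp_cvg0 hnutau eps1.
pose cl := ln (Cq ^+ 2 * limn (series lam)).
pose c1 := ln (bm 0%N ^+ 2 / (kap ^+ 2 * V 0%N)).
pose Ke := eta_const Cq beta gamma K1 K2.
have Ke0 : 0 <= Ke.
  by rewrite /Ke /eta_const !(mulr_ge0, addr_ge0) ?sqr_ge0
    ?(ltW Cq0) ?(ltW hgamma) ?(ltW K10) ?(ltW K20) ?(ltW hbeta).
(* Three demands on [- ln (sigma ^+ 2)]: [Lam0] for the balancing, [2 * l0 + |cl|] so that the last
   candidate satisfies [Q] below, [|c1| + 1] so that index 0 does not. *)
pose LamS := Num.max Lam0 (Num.max (2 * l0 + `|cl|) (`|c1| + 1)).
have th20 : 0 < theta2.
  have /andP[h1 h2] := Vratio 0%N.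
  exact: lt_le_trans (lt_trans ltr01 theta) (le_trans h1 h2).
(* The first summand collects threshold, bias and noise at [M], all multiples of [v_M]. The second
   is the cost of late stops, with [128 + n <= 129 * n]. *)
pose C := (2 * Ke + 4 * kap ^+ 2 + 32) * (theta2 * C4) + 129 * Cm ^+ 2 * V 0%N * K3.
have C0 : 0 < C.
  rewrite ltr_pwDr ?mulr_gt0 ?exprn_gt0//.
  apply: mulr_ge0; last by rewrite ltW// mulr_gt0.
  by apply: addr_ge0 => //; apply: addr_ge0; apply: mulr_ge0 => //; rewrite sqr_ge0.
exists C => //; exists (expR (- LamS / 2)); first exact: expR_gt0.
move=> sigma /andP[s0 ss0].
have s2 : 0 < sigma ^+ 2 by rewrite exprn_gt0.
pose Lam := - ln (sigma ^+ 2).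
have sE : sigma ^+ 2 = expR (- Lam) by rewrite /Lam opprK lnK ?posrE.
have LamSL : LamS <= Lam.
  move: ss0; rewrite -[sigma]lnK ?posrE// ltr_expR => h.
  by rewrite /Lam lnXn// mulr2n; lra.
have [LamL0 [Lamcl Lamc1]] : Lam0 <= Lam /\ (2 * l0 + `|cl| <= Lam /\ `|c1| + 1 <= Lam).
  by move: LamSL; rewrite /LamS !ge_max => /and3P[].
have Lam1 : 1 <= Lam := le_trans Lam01 LamL0.
have [mM1 mMV mMlt] := mmax_spec lam0 clam Cq0 al0 q0 qC theta Vratio s0.
set n := mmax lam q al sigma in mM1 mMV mMlt.
have nle : n%:R <= Cm * Lam by exact: Hmmax.
pose Q : set nat := [set m | bm m ^+ 2 <= kap ^+ 2 * (sigma ^+ 2 * V m)].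
have Qn : Q n.
  rewrite /Q/= (@le_trans _ _ (kap ^+ 2))//; last by rewrite ler_peMr ?sqr_ge0.
  rewrite ler_pXn2r ?nnegrE// ?(ltW kap0)//.
  have Ln : l0 <= L n.
    have := log_al_ge al0 (Vgt0 0%N) Cq0 Val s2 mMV.
    rewrite -/cl -/(L n) -/Lam; have := ler_norm cl; lra.
  have := Hl0 _ Ln; rewrite ler_pdivlMr ?mulr_gt0// /bm; apply: le_trans.
  by rewrite le_eqVlt; apply/orP; left; apply/eqP; ring.
have [QM Mmin] : Q (nat_min Q) /\ forall j, Q j -> (nat_min Q <= j)%N.
  by apply: nat_minP; exists n.
set M := nat_min Q in QM Mmin.
have Mn : (M <= n)%N by exact: Mmin.
have bm00 : 0 < bm 0%N.
  rewrite !mulr_gt0 ?expR_gt0 ?powR_gt0// (lt_le_trans ltr01 (L1 0%N))//.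
(* This gives [M] a predecessor, at which [Q] fails. *)
have Q0 : ~ Q 0%N.
  have X0 : 0 < bm 0%N ^+ 2 / (kap ^+ 2 * V 0%N).
    by apply: divr_gt0; [exact: exprn_gt0|rewrite mulr_gt0// exprn_gt0].
  have : expR (- Lam) < bm 0%N ^+ 2 / (kap ^+ 2 * V 0%N).
    rewrite -[X in _ < X]lnK ?posrE// ltr_expR -/c1.
    by have := ler_norm (- c1); rewrite normrN; lra.
  rewrite -sE ltr_pdivlMr => [h|]; last by rewrite mulr_gt0// exprn_gt0.
  by rewrite /Q/=; apply/negP; rewrite -ltNge [X in X < _]mulrCA.
have vM : sigma ^+ 2 * V M <= theta2 * C4 * rate nu tau vartheta^-1 Lam.
  case ME : M QM => [//|M'] _.
  have QM' : ~ Q M' by move=> /Mmin; rewrite ME ltnn.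
  have /andP[_ hth] := Vfun_S lam0 clam Cq0 al0 q0 qC theta Vratio M'.
  apply: (@le_trans _ _ (theta2 * (sigma ^+ 2 * V M'))).
    by rewrite mulrCA ler_pM2l.
  rewrite -mulrA ler_pM2l//; apply: (Hrate _ (L M')) => //.
    by rewrite -sE ler_pM2l.
  move/negP : QM'; rewrite -ltNge => /ltW; rewrite mulrC -ler_pdivlMr ?exprn_gt0//.
  move=> /le_trans; apply.
  by rewrite /bm le_eqVlt; apply/orP; left; apply/eqP; ring.
have rate0 : 0 <= rate nu tau vartheta^-1 Lam.
  by rewrite /rate mulr_ge0 ?expR_ge0 ?powR_ge0.
apply: ge_ereal_sup => _ [f hf <-].
have hB m : `|bias lam q al ipX e Af m f| ^+ 2 <= bm m ^+ 2.
  by rewrite ler_pXn2r ?nnegrE// bias_le.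
have hBM : `|bias lam q al ipX e Af M f| ^+ 2 <= kap ^+ 2 * (sigma ^+ 2 * V M).
  exact: le_trans (hB M) QM.
pose etaM := Num.sqrt (Ke * (sigma ^+ 2 * V M)).
have vM0 m : 0 <= sigma ^+ 2 * V m by rewrite mulr_ge0// ltW.
have etaM2 : etaM ^+ 2 = Ke * (sigma ^+ 2 * V M).
  by rewrite sqr_sqrtr// mulr_ge0.
have hEta m1 : (m1 < M)%N -> Defs.eta lam q al z beta gamma sigma m1 M <= etaM.
  exact: (eta_le hipX hTadj heig hZ hTZ Cq0 al0 q0 qC q1 qmono theta Vratio hz
    hbeta hgamma lnV logal K10 K20 s0).
pose E m m2 := [set w | z m m2 (xm lam q al sigma gamma m) <
  noise_diff ipX e lam q al m m2 (TZ w)].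
(* [r m.+1 ^+ 2 = exp (- x_m)] is the probability of the event [E m m2], and [r m * V m <= V 0]
   because the exponent [1 + gamma] is at least 1. *)
pose r m := expR (- ((1 + gamma) * ln (V m / V 0%N))).
pose c0 := 2 * etaM ^+ 2 + 4 * (kap ^+ 2 * (sigma ^+ 2 * V M)).
have kv0 : 0 <= kap ^+ 2 * (sigma ^+ 2 * V M) by rewrite mulr_ge0 ?sqr_ge0.
have c00 : 0 <= c0.
  by apply: addr_ge0; apply: mulr_ge0 => //; exact: sqr_ge0.
have bound := @expectation_le R d Omega P
  (fun w => `|fhat ipX e lam q
     (al (solit ipX e lam q al z beta gamma sigma (TY f sigma w)))
     (TY f sigma w) - f| ^+ 2)
  (fun m w => `|fhat ipX e lam q (al m) (TZ w)| ^+ 2) E V r M n c0 (sigma ^+ 2) (V 0%N).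
rewrite unlock; apply: le_trans (bound _ _ _ _ _ _ _ _ _ _ _ _ _) _ => //; rewrite {bound}.
- exact: ltW.
- exact: (measurable_noise hipX heig hTZ al0 q0 qC).
- move=> m m2; rewrite (_ : E m m2 = setT `&`
    (fun w => noise_diff ipX e lam q al m m2 (TZ w)) @^-1`
      `]z m m2 (xm lam q al sigma gamma m), +oo[%classic).
    exact: (measurable_noise_diff hipX heig hTZ al0 q0 qC).
  by rewrite setTI; apply/seteqP; split => w /=; rewrite in_itv/= andbT.
- by move=> m; exact: expR_gt0.
- move=> m; have V1 : 0 <= ln (V m / V 0%N).
    by rewrite ln_ge0// ler_pdivlMr// mul1r Vmono.
  apply: (@le_trans _ _ (expR (- ln (V m / V 0%N)) * V m)).
    rewrite ler_pM2r// ler_expR lerN2 mulrDl mul1r lerDl.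
    by rewrite mulr_ge0// ltW.
  rewrite expRN lnK ?posrE ?divr_gt0// invf_div divfK// gt_eqF//.
- exact: (noise_first_moment hipX hTadj heig hZ hTZ Cq0 al0 q0 qC theta Vratio).
- exact: (noise_second_moment hipX hTadj heig hZ hTZ Cq0 al0 q0 qC theta Vratio).
- move=> m m2 mm2; rewrite hz//; last first.
    exact: (xm_gt0 heig Cq0 al0 q0 qC theta Vratio hgamma).
  rewrite lee_fin expr2 -expRD ler_expR /xm /vm -mulf_div divff ?gt_eqF// mul1r.
  by rewrite -/(V _) -/(V 0%N); lra.
- have := observation_eq hipX hTadj he hTZ (hTY f sigma s0).
  apply: filterS => w ->.
  have := solit_dichotomy lam0 clam Cq0 al0 q0 qC q1 qmono theta Vratio hipX he hAf
    (gamma := gamma) hbeta s0 (TZ w) Mn hBM hEta.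
  rewrite -/Af /=; case=> [h|[m [Mm mn h [m2 mm2 zm]]]].
    left; apply: (le_trans h); rewrite lerD2r /c0 lerD2l.
    by rewrite ler_pM2l.
  right; exists m; split => //; last by exists m2.
  apply: (le_trans h); rewrite lerD2r /c0.
  by have := sqr_ge0 etaM; move: hBM kv0; lra.
rewrite lee_fin -[leRHS]mulrA.
have -> : (sigma ^+ 2) `^ (2 * nu / (2 * nu + 1)) *
    (- ln (sigma ^+ 2)) `^ ((2 * nu / vartheta - 2 * tau) / (2 * nu + 1)) =
    rate nu tau vartheta^-1 Lam.
  by rewrite /rate [X in X * _]powR_expR_ln// /Lam mulrN opprK.
have n1 : 1 <= n%:R :> R by rewrite ler1n.
have hn : n%:R * (sigma ^+ 2 * (128 + n%:R) * V 0%N) <=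
    129 * Cm ^+ 2 * V 0%N * K3 * rate nu tau vartheta^-1 Lam.
  have n2 : n%:R * (128 + n%:R) <= 129 * (Cm * Lam) ^+ 2 :> R.
    apply: (@le_trans _ _ (129 * n%:R ^+ 2)); last first.
      rewrite ler_pM2l// ler_pXn2r ?nnegrE//.
      by rewrite (le_trans _ nle).
    by move: n1; set x := n%:R => n1; nra.
  apply: (@le_trans _ _ (sigma ^+ 2 * V 0%N * (129 * (Cm * Lam) ^+ 2))).
    rewrite [leLHS](_ : _ = sigma ^+ 2 * V 0%N * (n%:R * (128 + n%:R))); last by ring.
    by rewrite ler_wpM2l.
  rewrite [leLHS](_ : _ = 129 * Cm ^+ 2 * V 0%N * (expR (- Lam) * Lam ^+ 2)); last first.
    by rewrite -sE; ring.
  rewrite -[leRHS]mulrA ler_wpM2l ?HK3//.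
  by apply: mulr_ge0; [apply: mulr_ge0 => //; exact: sqr_ge0|exact: ltW].
rewrite /C [leRHS]mulrDl lerD// /c0 etaM2.
have -> : 2 * (Ke * (sigma ^+ 2 * V M)) + 4 * (kap ^+ 2 * (sigma ^+ 2 * V M)) +
    32 * (sigma ^+ 2 * V M) = (2 * Ke + 4 * kap ^+ 2 + 32) * (sigma ^+ 2 * V M) by ring.
rewrite -mulrA ler_wpM2l//.
by apply: addr_ge0 => //; apply: addr_ge0; apply: mulr_ge0 => //; exact: sqr_ge0.
Qed.
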